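(* Let $\mathcal{C}$ be a 2-Calabi-Yau Krull-Schmidt triangulated category. Let $\mathcal{Z}$ be a functorially finite rigid subcategory of $\mathcal{C}$. If $\mathcal{C}$ has a directed cluster-tilting subcategory, then the reduction $\mathcal{C}_{[\mathcal{Z}]}$ also has a directed cluster-tilting subcategory.
   Context: $k$ is an algebraically closed field; all categories and functors are $k$-linear and essentially small. A Hom-finite additive category is Krull-Schmidt iff idempotents split. A triangulated category is 2-Calabi-Yau if it is Hom-finite and has a Serre functor $\mathbb{S}$ with $\mathbb{S}\cong[2]$ as triangle functors. $\operatorname{Ext}^1(X,Y)=\operatorname{Hom}(X,Y[1])$. Subcategories are full and additive. A subcategory $\mathcal{Z}\subseteq\mathcal{C}$ is functorially finite if every object of $\mathcal{C}$ has a right $\mathcal{Z}$-approximation (a map $Z_0\to X$ with $Z_0\in\mathcal{Z}$ through which every map from an object of $\mathcal{Z}$ to $X$ factors) and, dually, a left $\mathcal{Z}$-approximation. It is rigid if $\operatorname{Ext}^1(Z,Z')=0$ for all $Z,Z'\in\mathcal{Z}$. A cluster-tilting subcategory is a functorially finite $\mathcal{T}$ with $\mathcal{T}=\{X\mid\operatorname{Ext}^1(\mathcal{T},X)=0\}=\{X\mid\operatorname{Ext}^1(X,\mathcal{T})=0\}$. A cycle in a Krull-Schmidt category is a sequence $X_0,\dots,X_n$ ($n\ge1$) of indecomposables with $X_0\cong X_n$ and a nonzero noninvertible morphism $X_i\to X_{i+1}$ for each $0\le i<n$; the category is directed if it has no cycles. Iyama-Yoshino reduction: for $\mathcal{Z}$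 rigid and functorially finite, put $\mathcal{Z}^{\perp_1}=\{C\in\mathcal{C}\mid\operatorname{Ext}^1(\mathcal{Z},C)=0\}$ and $\mathcal{C}_{[\mathcal{Z}]}=\mathcal{Z}^{\perp_1}/[\mathcal{Z}]$, the quotient by the ideal $[\mathcal{Z}]$ of morphisms factoring through an object of $\mathcal{Z}$. It is a 2-Calabi-Yau triangulated category (Iyama-Yoshino): the suspension $X\langle1\rangle$ is defined by a triangle $X\to X'\to X\langle1\rangle\to X[1]$ in $\mathcal{C}$ with $X\to X'$ a minimal left $\mathcal{Z}$-approximation, and the distinguished triangles are (up to isomorphism) the complexes $A\to B\to C\to A\langle1\rangle$ induced by triangles $A\to B\to C\to A[1]$ of $\mathcal{C}$ with $A,B,C\in\mathcal{Z}^{\perp_1}$. *)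

(* Defs.v *)
From HB Require Import structures.
From mathcomp Require Import all_boot all_algebra.
From mathcomp Require Import ring_quotient generic_quotient boolp.
From Stdlib Require Import ClassicalEpsilon.
Set Implicit Arguments.
Unset Strict Implicit.
Unset Printing Implicit Defensive.
Import GRing.Theory.
Local Open Scope ring_scope.
Local Open Scope quotient_scope.

(* Equality of objects plays no role anywhere: objects form a bare type, and
   subcategories are full subcategories given by predicates on objects. *)
Record linCat (k : fieldType) := LinCat {
  ob :> Type;
  hom : ob -> ob -> lmodType k;
  idm : forall X, hom X X;
  mcomp : forall X Y Z, hom Y Z -> hom X Y -> hom X Z;
  comp1m : forall X Y (f : hom X Y), mcomp (idm Y) f = f;
  compm1 : forall X Y (f : hom X Y), mcomp f (idm X) = f;
  compA : forall X Y Z W (h : hom Z W) (g : hom Y Z) (f : hom X Y),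
    mcomp h (mcomp g f) = mcomp (mcomp h g) f;
  comp_linl : forall X Y Z a (g g' : hom Y Z) (f : hom X Y),
    mcomp (a *: g + g') f = a *: mcomp g f + mcomp g' f;
  comp_linr : forall X Y Z a (g : hom Y Z) (f f' : hom X Y),
    mcomp g (a *: f + f') = a *: mcomp g f + mcomp g f'
}.

Arguments hom {k l}.
Arguments idm {k l}.
Arguments mcomp {k l X Y Z}.

Notation "g ⊚ f" := (mcomp g f) (at level 40, left associativity).

Section Categories.
Variable k : fieldType.

Section Basics.
Variable C : linCat k.
Implicit Types X Y Z A B : C.

Definition is_iso X Y (f : hom X Y) :=
  exists g : hom Y X, g ⊚ f = idm X /\ f ⊚ g = idm Y.

Definition isomorphic X Y := exists f : hom X Y, is_iso f.

Definition is_zero X :=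
  (forall Y (f : hom X Y), f = 0) /\ (forall Y (f : hom Y X), f = 0).

Definition biproduct A B X :=
  exists (iA : hom A X) (iB : hom B X) (pA : hom X A) (pB : hom X B),
    [/\ pA ⊚ iA = idm A, pB ⊚ iB = idm B, pA ⊚ iB = 0, pB ⊚ iA = 0
      & iA ⊚ pA + iB ⊚ pB = idm X].

Definition direct_sum n (A : 'I_n -> C) X :=
  exists (i : forall j, hom (A j) X) (p : forall j, hom X (A j)),
    [/\ forall j, p j ⊚ i j = idm (A j),
        forall j l, j <> l -> p j ⊚ i l = 0
      & \sum_(j < n) i j ⊚ p j = idm X].

Definition indecomposable X :=
  ~ is_zero X /\ forall A B, biproduct A B X -> is_zero A \/ is_zero B.

Definition local_end X :=
  ~ is_zero X /\
  forall f g : hom X X, ~ is_iso f -> ~ is_iso g -> ~ is_iso (f + g).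

End Basics.

Section Finiteness.
Variable C : linCat k.

Definition additive_cat :=
  (exists O : C, is_zero O) /\ forall A B : C, exists X, biproduct A B X.

Definition hom_finite :=
  forall X Y : C, exists n (e : 'I_n -> hom X Y),
  forall f, exists c : 'I_n -> k, f = \sum_(i < n) c i *: e i.

Definition krull_schmidt :=
  additive_cat /\
  forall X : C, exists n (A : 'I_n -> C),
    (forall i, local_end (A i)) /\ direct_sum A X.

Definition hom_cycle (n : nat) (X : nat -> C) :=
  [/\ (0 < n)%N,
      forall i, (i <= n)%N -> indecomposable (X i),
      isomorphic (X 0%N) (X n)
    & forall i, (i < n)%N -> exists f : hom (X i) (X i.+1), f <> 0 /\ ~ is_iso f].

Definition directed := forall n X, ~ hom_cycle n X.

(* Full additive subcategory.  Neither closure under isomorphism nor closure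
   under direct summands is required. *)
Record subcat := Subcat {
  smem :> C -> Prop;
  subcat0 : exists O, smem O /\ is_zero O;
  subcatD : forall A B, smem A -> smem B -> exists X, smem X /\ biproduct A B X
}.

(* Since Z need not be closed under direct summands, its minimal approximations
   have to be taken in add Z (which is Z if Z is closed under summands). *)
Definition add_mem (Z : subcat) (X : C) :=
  exists A B, Z A /\ biproduct X B A.

Definition right_approx (Z : subcat) Z0 X (f : hom Z0 X) :=
  Z Z0 /\ forall W (u : hom W X), Z W -> exists v : hom W Z0, f ⊚ v = u.

Definition left_approx (Z : subcat) X Z0 (f : hom X Z0) :=
  Z Z0 /\ forall W (u : hom X W), Z W -> exists v : hom Z0 W, v ⊚ f = u.

Definition min_left_approx (Z : subcat) X Z0 (f : hom X Z0) :=
  [/\ add_mem Z Z0,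
      forall W (u : hom X W), Z W -> exists v : hom Z0 W, v ⊚ f = u
    & forall g : hom Z0 Z0, g ⊚ f = f -> is_iso g].

Definition functorially_finite (Z : subcat) :=
  (forall X, exists Z0 (f : hom Z0 X), right_approx Z f) /\
  (forall X, exists Z0 (f : hom X Z0), left_approx Z f).

Definition full_sub (P : C -> Prop) : linCat k :=
  @LinCat k {X | P X} (fun X Y => hom (sval X) (sval Y))
    (fun X => idm (sval X)) (fun X Y Z g f => g ⊚ f)
    (fun X Y => @comp1m k C (sval X) (sval Y))
    (fun X Y => @compm1 k C (sval X) (sval Y))
    (fun X Y Z W => @compA k C (sval X) (sval Y) (sval Z) (sval W))
    (fun X Y Z => @comp_linl k C (sval X) (sval Y) (sval Z))
    (fun X Y Z => @comp_linr k C (sval X) (sval Y) (sval Z)).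

End Finiteness.

Section Functors.

(* A functor without its laws, which are stated by [linear_functor]. *)
Record prefunctor (C D : linCat k) := Prefunctor {
  fob :> C -> D;
  fmap : forall X Y : C, hom X Y -> hom (fob X) (fob Y)
}.

Variables C D : linCat k.

Definition linear_functor (F : prefunctor C D) :=
  [/\ forall X : C, fmap F (idm X) = idm (F X),
      forall (X Y Z : C) (g : hom Y Z) (f : hom X Y),
        fmap F (g ⊚ f) = fmap F g ⊚ fmap F f
    & forall (X Y : C) a (f g : hom X Y),
        fmap F (a *: f + g) = a *: fmap F f + fmap F g].

Definition equivalence (F : prefunctor C D) :=
  [/\ linear_functor F,
      forall X Y : C, bijective (@fmap _ _ F X Y)
    & forall Y : D, exists X : C, isomorphic (F X) Y].

End Functors.

(* A category with a suspension and a class of triangles X -> Y -> Z -> X[1];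
   the axioms are stated by [triangulated]. *)
Record triCat := TriCat {
  tcat :> linCat k;
  tshift : prefunctor tcat tcat;
  dist : forall X Y Z : tcat,
    hom X Y -> hom Y Z -> hom Z (tshift X) -> Prop
}.

Arguments dist {t X Y Z}.

Local Notation "X '[1]'" := (tshift _ X) (at level 2, format "X [1]").
Local Notation "f '⟦1⟧'" := (fmap (tshift _) f) (at level 2, format "f ⟦1⟧").

Section Triangulated.
Variable C : triCat.

Definition tri_iso_closed :=
  forall (X Y Z X' Y' Z' : C)
    (f : hom X Y) (g : hom Y Z) (h : hom Z X[1])
    (f' : hom X' Y') (g' : hom Y' Z') (h' : hom Z' X'[1])
    (u : hom X X') (v : hom Y Y') (w : hom Z Z'),
  is_iso u -> is_iso v -> is_iso w ->
  v ⊚ f = f' ⊚ u -> w ⊚ g = g' ⊚ v -> u⟦1⟧ ⊚ h = h' ⊚ w ->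
  dist f g h -> dist f' g' h'.

Definition tr1 :=
  (forall X O : C, is_zero O ->
     dist (idm X) (0 : hom X O) (0 : hom O X[1])) /\
  (forall (X Y : C) (f : hom X Y),
     exists Z (g : hom Y Z) (h : hom Z X[1]), dist f g h).

Definition tr2 :=
  forall (X Y Z : C) (f : hom X Y) (g : hom Y Z) (h : hom Z X[1]),
  dist f g h <-> dist g h (- f⟦1⟧).

Definition tr3 :=
  forall (X Y Z X' Y' Z' : C)
    (f : hom X Y) (g : hom Y Z) (h : hom Z X[1])
    (f' : hom X' Y') (g' : hom Y' Z') (h' : hom Z' X'[1])
    (u : hom X X') (v : hom Y Y'),
  dist f g h -> dist f' g' h' -> v ⊚ f = f' ⊚ u ->
  exists w : hom Z Z', w ⊚ g = g' ⊚ v /\ u⟦1⟧ ⊚ h = h' ⊚ w.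

Definition tr4 :=
  forall (X Y Z X' Y' Z' : C) (f : hom X Y) (g : hom Y Z)
    (f1 : hom Y Z') (f2 : hom Z' X[1])
    (g1 : hom Z X') (g2 : hom X' Y[1])
    (h1 : hom Z Y') (h2 : hom Y' X[1]),
  dist f f1 f2 -> dist g g1 g2 -> dist (g ⊚ f) h1 h2 ->
  exists (u : hom Z' Y') (v : hom Y' X'),
    [/\ dist u v (f1⟦1⟧ ⊚ g2),
        u ⊚ f1 = h1 ⊚ g, h2 ⊚ u = f2, v ⊚ h1 = g1 & g2 ⊚ v = f⟦1⟧ ⊚ h2].

Definition triangulated :=
  [/\ additive_cat C, equivalence (tshift C) & tri_iso_closed] /\
  [/\ tr1, tr2, tr3 & tr4].

Section Serre.
Variable S : prefunctor C C.

(* [phi X Y f g] is the value at [g] of the functional associated with [f]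
   under the bifunctorial isomorphism Hom(X, Y) = D Hom(Y, S X). *)
Definition serre_duality (phi : forall X Y : C, hom X Y -> {scalar hom Y (S X)}) :=
  [/\ forall (X Y : C) a (f f' : hom X Y) g,
        phi _ _ (a *: f + f') g = a * phi _ _ f g + phi _ _ f' g,
      forall (X Y : C) (f : hom X Y), (forall g, phi _ _ f g = 0) -> f = 0
    & forall (X Y : C) (l : {scalar hom Y (S X)}),
        exists f : hom X Y, forall g, phi _ _ f g = l g] /\
  [/\ forall (X Y Y' : C) (b : hom Y Y') (f : hom X Y) (g : hom Y' (S X)),
        phi _ _ (b ⊚ f) g = phi _ _ f (g ⊚ b)
    & forall (X X' Y : C) (a : hom X' X) (f : hom X Y) (g : hom Y (S X')),
        phi _ _ (f ⊚ a) g = phi _ _ f (fmap S a ⊚ g)].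

(* The canonical isomorphism S(X[1]) = (S X)[1] turning a Serre functor into a
   triangle functor (Bondal-Kapranov, Van den Bergh): writing Tr_X for the
   functional [phi X X (idm X)] on Hom(X, S X), it is characterized by
   Tr_{X[1]}(eta_X^{-1} o f[1]) = - Tr_X(f).  The sign makes (S, eta) exact. *)
Definition serre_shift (phi : forall X Y : C, hom X Y -> {scalar hom Y (S X)})
    (eta : forall X : C, hom (S X[1]) (S X)[1]) :=
  (forall X, is_iso (eta X)) /\
  forall (X : C) (f : hom X (S X)) (f' : hom X[1] (S X[1])),
    eta X ⊚ f' = f⟦1⟧ ->
    phi _ _ (idm X[1]) f' = - phi _ _ (idm X) f.

(* (S, eta) is a triangle functor. *)
Definition triangle_functor (eta : forall X : C, hom (S X[1]) (S X)[1]) :=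
  [/\ linear_functor S,
      forall X, is_iso (eta X),
      forall (X Y : C) (f : hom X Y),
        eta Y ⊚ fmap S f⟦1⟧ = (fmap S f)⟦1⟧ ⊚ eta X
    & forall (X Y Z : C) (f : hom X Y) (g : hom Y Z) (h : hom Z X[1]),
        dist f g h -> dist (fmap S f) (fmap S g) (eta X ⊚ fmap S h)].

(* An isomorphism of triangle functors from (S, eta) to [2].  Here [2] is the
   square of ([1], -id), that is, [2] with the identity of [3]. *)
Definition iso_shift2 (eta : forall X : C, hom (S X[1]) (S X)[1])
    (theta : forall X : C, hom (S X) X[1][1]) :=
  [/\ forall X, is_iso (theta X),
      forall (X Y : C) (f : hom X Y),
        theta Y ⊚ fmap S f = f⟦1⟧⟦1⟧ ⊚ theta X
    & forall X, theta X[1] = (theta X)⟦1⟧ ⊚ eta X].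

End Serre.

Definition calabi_yau2 :=
  hom_finite C /\
  exists (S : prefunctor C C) phi eta theta,
    [/\ equivalence S, @serre_duality S phi, @serre_shift S phi eta,
        @triangle_functor S eta & @iso_shift2 S eta theta].

Definition Ext1 (X Y : C) := hom X Y[1].

Definition rigid (Z : subcat C) :=
  forall X Y, Z X -> Z Y -> forall f : Ext1 X Y, f = 0.

Definition cluster_tilting (T : subcat C) :=
  [/\ functorially_finite T,
      forall X : C, T X <-> forall Y, T Y -> forall f : Ext1 Y X, f = 0
    & forall X : C, T X <-> forall Y, T Y -> forall f : Ext1 X Y, f = 0].

Definition perp1 (Z : subcat C) (X : C) :=
  forall Y, Z Y -> forall f : Ext1 Y X, f = 0.

End Triangulated.

End Categories.

Arguments dist {k t X Y Z}.

Record linSub (k : fieldType) (V : lmodType k) := LinSub {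
  lmem :> V -> Prop;
  lmem0 : lmem 0;
  lmemP : forall a u v, lmem u -> lmem v -> lmem (a *: u + v)
}.

Section ModuleQuotient.
Variables (k : fieldType) (V : lmodType k) (I : linSub V).

Definition lmemb : {pred V} := fun v => `[< I v >].

Fact lmemb_zmod_closed : zmod_closed lmemb.
Proof.
split=> [|u v /asboolP Iu /asboolP Iv]; apply/asboolP; first exact: lmem0.
by rewrite addrC -scaleN1r; apply: lmemP.
Qed.

HB.instance Definition _ := GRing.isZmodClosed.Build V lmemb lmemb_zmod_closed.

Definition modQuot := Quotient.quot lmemb.
HB.instance Definition _ := GRing.Zmodule.on modQuot.

Definition qpi (v : V) : modQuot := \pi v.

Lemma qpiP (u v : V) : qpi u = qpi v <-> I (u - v).
Proof.
have e : I (u - v) <-> u - v \in lmemb by split=> /asboolP.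
by rewrite e Quotient.idealrBE; split=> /eqP.
Qed.

Lemma qpi_surj (x : modQuot) : exists v, qpi v = x.
Proof. by exists (repr x); apply: reprK. Qed.

Lemma qpiD u v : qpi (u + v) = qpi u + qpi v.
Proof. exact: Quotient.pi_add. Qed.

Definition qscale (a : k) (x : modQuot) : modQuot := qpi (a *: repr x).

Lemma qscaleE a v : qscale a (qpi v) = qpi (a *: v).
Proof.
apply/qpiP; rewrite -scalerBr -[_ *: _]addr0; apply: lmemP; last exact: lmem0.
by apply/qpiP; apply: reprK.
Qed.

Fact qscaleA a b x : qscale a (qscale b x) = qscale (a * b) x.
Proof. by have [v <-] := qpi_surj x; rewrite !qscaleE scalerA. Qed.
Fact qscale1 : left_id 1 qscale.
Proof. by move=> x; have [v <-] := qpi_surj x; rewrite qscaleE scale1r. Qed.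
Fact qscaleDr : right_distributive qscale +%R.
Proof.
move=> a x y; have [u <-] := qpi_surj x; have [v <-] := qpi_surj y.
by rewrite -qpiD !qscaleE -qpiD scalerDr.
Qed.
Fact qscaleDl x : {morph qscale^~ x : a b / a + b}.
Proof.
by move=> a b; have [v <-] := qpi_surj x; rewrite !qscaleE -qpiD scalerDl.
Qed.

HB.instance Definition _ := GRing.Zmodule_isLmodule.Build k modQuot
  qscaleA qscale1 qscaleDr qscaleDl.

Lemma qpiL a u v : qpi (a *: u + v) = a *: qpi u + qpi v.
Proof. by rewrite qpiD -qscaleE. Qed.

End ModuleQuotient.

Section QuotientCategory.
Variables (k : fieldType) (C : linCat k).
Implicit Types X Y Z W : C.

Record cat_ideal := Ideal {
  isub :> forall X Y : C, linSub (hom X Y);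
  ideal_compl : forall X Y Z (g : hom Y Z) (f : hom X Y),
    isub _ _ f -> isub _ _ (g ⊚ f);
  ideal_compr : forall X Y Z (g : hom Y Z) (f : hom X Y),
    isub _ _ g -> isub _ _ (g ⊚ f)
}.

Variable I : cat_ideal.

Local Notation qhom X Y := (modQuot (I X Y)).

Definition qcomp X Y Z (g : qhom Y Z) (f : qhom X Y) : qhom X Z :=
  qpi _ ((repr g : hom Y Z) ⊚ (repr f : hom X Y)).

Lemma compBl X Y Z (g g' : hom Y Z) (f : hom X Y) :
  (g - g') ⊚ f = g ⊚ f - g' ⊚ f.
Proof. by rewrite addrC -scaleN1r comp_linl scaleN1r addrC. Qed.

Lemma compBr X Y Z (g : hom Y Z) (f f' : hom X Y) :
  g ⊚ (f - f') = g ⊚ f - g ⊚ f'.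
Proof. by rewrite addrC -scaleN1r comp_linr scaleN1r addrC. Qed.

Lemma qcompE X Y Z (g : hom Y Z) (f : hom X Y) :
  qcomp (qpi _ g) (qpi _ f) = qpi _ (g ⊚ f).
Proof.
rewrite /qcomp; set g' : hom Y Z := repr _; set f' : hom X Y := repr _.
have Ig : I _ _ (g' - g) by apply/qpiP; apply: reprK.
have If : I _ _ (f' - f) by apply/qpiP; apply: reprK.
apply/qpiP; have -> : g' ⊚ f' - g ⊚ f = 1 *: (g' ⊚ (f' - f)) + (g' - g) ⊚ f.
  by rewrite compBl compBr scale1r addrA subrK.
by apply: lmemP; [apply: ideal_compl | apply: ideal_compr].
Qed.

Fact qcomp1m X Y (f : qhom X Y) : qcomp (qpi _ (idm Y)) f = f.
Proof. by have [u <-] := qpi_surj f; rewrite qcompE comp1m. Qed.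
Fact qcompm1 X Y (f : qhom X Y) : qcomp f (qpi _ (idm X)) = f.
Proof. by have [u <-] := qpi_surj f; rewrite qcompE compm1. Qed.
Fact qcompA X Y Z W (h : qhom Z W) (g : qhom Y Z) (f : qhom X Y) :
  qcomp h (qcomp g f) = qcomp (qcomp h g) f.
Proof.
have [u <-] := qpi_surj f; have [v <-] := qpi_surj g.
by have [w <-] := qpi_surj h; rewrite !qcompE compA.
Qed.
Fact qcomp_linl X Y Z a (g g' : qhom Y Z) (f : qhom X Y) :
  qcomp (a *: g + g') f = a *: qcomp g f + qcomp g' f.
Proof.
have [u <-] := qpi_surj f; have [v <-] := qpi_surj g.
by have [w <-] := qpi_surj g'; rewrite -qpiL !qcompE comp_linl qpiL.
Qed.
Fact qcomp_linr X Y Z a (g : qhom Y Z) (f f' : qhom X Y) :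
  qcomp g (a *: f + f') = a *: qcomp g f + qcomp g f'.
Proof.
have [u <-] := qpi_surj f; have [v <-] := qpi_surj g.
by have [w <-] := qpi_surj f'; rewrite -qpiL !qcompE comp_linr qpiL.
Qed.

Definition quot_cat : linCat k :=
  @LinCat k C (fun X Y => qhom X Y) (fun X => qpi _ (idm X)) qcomp
    qcomp1m qcompm1 qcompA qcomp_linl qcomp_linr.

End QuotientCategory.

Section FactorIdeal.
Variables (k : fieldType) (C : linCat k) (Z : subcat C).
Implicit Types X Y : C.

Definition factors (X Y : C) (f : hom X Y) :=
  exists W (a : hom X W) (b : hom W Y), Z W /\ b ⊚ a = f.

Fact factors0 X Y : factors (0 : hom X Y).
Proof.
have [O [ZO [_ O0]]] := subcat0 Z.
exists O, 0, 0; split=> //.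
by rewrite -(subrr (0 : hom O Y)) compBl subrr.
Qed.

Fact factors_lin X Y a (f g : hom X Y) :
  factors f -> factors g -> factors (a *: f + g).
Proof.
move=> [A [f1 [f2 [ZA <-]]]] [B [g1 [g2 [ZB <-]]]].
have [W [ZW [iA [iB [pA [pB [eA eB eAB eBA _]]]]]]] := subcatD ZA ZB.
exists W, (a *: (iA ⊚ f1) + iB ⊚ g1), (1 *: (f2 ⊚ pA) + g2 ⊚ pB); split=> //.
rewrite comp_linr !comp_linl !scale1r -!compA.
rewrite !(compA pA) !(compA pB) eA eB eAB eBA !comp1m.
have z X' Y' Z' (u : hom X' Y') : (0 : hom Y' Z') ⊚ u = 0.
  by rewrite -(subrr (0 : hom Y' Z')) compBl subrr.
have z' X' Y' Z' (u : hom Y' Z') : u ⊚ (0 : hom X' Y') = 0.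
  by rewrite -(subrr (0 : hom X' Y')) compBr subrr.
by rewrite !z !z' addr0 add0r.
Qed.

Definition factor_sub X Y : linSub (hom X Y) :=
  LinSub (factors0 X Y) (@factors_lin X Y).

Fact factors_compl X Y Y' (g : hom Y Y') (f : hom X Y) :
  factors f -> factors (g ⊚ f).
Proof.
by case=> [W [a [b [ZW <-]]]]; exists W, a, (g ⊚ b); rewrite compA.
Qed.

Fact factors_compr X Y Y' (g : hom Y Y') (f : hom X Y) :
  factors g -> factors (g ⊚ f).
Proof.
by case=> [W [a [b [ZW <-]]]]; exists W, (a ⊚ f), b; rewrite compA.
Qed.

Definition factor_ideal : cat_ideal C :=
  @Ideal k C factor_sub factors_compl factors_compr.

End FactorIdeal.

Section Reduction.
Variables (k : fieldType) (C : triCat k) (Z : subcat C).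

(* The full subcategory of C/[Z] on the objects of Z^{perp_1}, which is the same
   as the quotient of Z^{perp_1} by the morphisms factoring through Z. *)
Definition reduction_cat : linCat k :=
  @full_sub k (quot_cat (factor_ideal Z)) (@perp1 k C Z).

Definition und (X : reduction_cat) : C := sval X.

Implicit Types X Y : reduction_cat.

Definition rpi X Y (f : hom (und X) (und Y)) : hom X Y :=
  qpi (factor_ideal Z (und X) (und Y)) f.

(* A candidate for the triangle X -> X' -> X<1> -> X[1] defining X<1>. *)
Record susp_data X := SuspData {
  sd_mid : C;
  susp : reduction_cat;
  sd_in : hom (und X) sd_mid;
  sd_out : hom sd_mid (und susp);
  sd_conn : hom (und susp) (tshift C (und X))
}.

Definition is_suspension X (d : susp_data X) :=
  min_left_approx Z (sd_in d) /\ dist (sd_in d) (sd_out d) (sd_conn d).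

(* A choice of the triangle defining X<1>.  It exists, and is unique up to
   isomorphism, when C is 2-Calabi-Yau and Krull-Schmidt and Z is rigid and
   functorially finite. *)
Definition suspension X : susp_data X :=
  epsilon (inhabits (@SuspData X (und X) X 0 0 0)) (@is_suspension X).

(* f<1> is the class of w for any morphism (u, v, w, u[1]) between the chosen
   triangles such that u lifts f; this class does not depend on u, v, w. *)
Definition is_susp_map X Y (f : hom X Y)
    (f1 : hom (susp (suspension X)) (susp (suspension Y))) :=
  exists (u : hom (und X) (und Y))
    (v : hom (sd_mid (suspension X)) (sd_mid (suspension Y)))
    (w : hom (und (susp (suspension X))) (und (susp (suspension Y)))),
  [/\ f = rpi u, f1 = rpi w &
   [/\ v ⊚ sd_in (suspension X) = sd_in (suspension Y) ⊚ u,
       w ⊚ sd_out (suspension X) = sd_out (suspension Y) ⊚ v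
     & fmap (tshift C) u ⊚ sd_conn (suspension X)
         = sd_conn (suspension Y) ⊚ w]].

Definition susp_functor : prefunctor reduction_cat reduction_cat :=
  @Prefunctor k reduction_cat reduction_cat (fun X => susp (suspension X))
    (fun X Y f => epsilon (inhabits 0) (@is_susp_map X Y f)).

(* The complex A -> B -> D -> A<1> induced by a triangle (a, b, c) of C: its
   last map is the class of w in a morphism of triangles (id, v, w, id) from
   (a, b, c) to the triangle defining A<1>. *)
Definition induced_triangle (A B D : reduction_cat)
    (f : hom A B) (g : hom B D) (h : hom D (susp_functor A)) :=
  exists (a : hom (und A) (und B)) (b : hom (und B) (und D))
    (c : hom (und D) (tshift C (und A)))
    (v : hom (und B) (sd_mid (suspension A)))
    (w : hom (und D) (und (susp (suspension A)))),
  [/\ dist a b c, f = rpi a, g = rpi b, h = rpi w &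
   [/\ v ⊚ a = sd_in (suspension A), w ⊚ b = sd_out (suspension A) ⊚ v
     & c = sd_conn (suspension A) ⊚ w]].

Definition reduction_dist (X Y W : reduction_cat)
    (x : hom X Y) (y : hom Y W) (z : hom W (susp_functor X)) :=
  exists (A B D : reduction_cat)
    (f : hom A B) (g : hom B D) (h : hom D (susp_functor A))
    (p : hom A X) (q : hom B Y) (r : hom D W),
  [/\ induced_triangle f g h, is_iso p, is_iso q, is_iso r &
   [/\ q ⊚ f = x ⊚ p, r ⊚ g = y ⊚ q
     & fmap susp_functor p ⊚ h = z ⊚ r]].

Definition reduction : triCat k :=
  @TriCat k reduction_cat susp_functor reduction_dist.

End Reduction.

(* Main.v *)
From mathcomp Require Import all_boot all_algebra.
From mathcomp Require Import boolp.
From Stdlib Require Import ClassicalEpsilon.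
Require Import Defs.
Set Implicit Arguments.
Unset Strict Implicit.
Unset Printing Implicit Defensive.
Import GRing.Theory.
Local Open Scope ring_scope.

(* Let [B_X] be the summand over [X] in [T] of the Bongartz completion of [Z],
   defined by a triangle [X -> B_X -> Z_X -> X[1]] whose last map is a right
   [Z]-approximation.  The objects [Y] of [Z]^{perp_1} with
   [Ext^1(B_X, Y) = 0] for all [X] form a cluster-tilting subcategory [T'] of
   [C], hence of the reduction, and every object of [T'] is a retract of some
   [B_X] modulo [Z].

   Directedness is handled through heredity: kernels are split off.  In [T],
   directedness makes the composite [E -> N -> E2] of the two exchange triangles
   of an indecomposable zero, so that left almost split maps are epimorphisms,
   and this forces weak kernels to be split.  This property passes to [T'/[Z]],
   as modules over [T'/[Z]] form a wide subcategory of the modules over the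
   hereditary [T] (here the argument is made explicit on morphisms).  Then
   nonzero maps between indecomposables of [T'/[Z]] are monomorphisms, and a
   cycle would give a monic, hence invertible, endomorphism. *)

Local Notation "X '[1]'" := (tshift _ X) (at level 2, format "X [1]").
Local Notation "f '⟦1⟧'" := (fmap (tshift _) f) (at level 2, format "f ⟦1⟧").

(** * Linear categories *)

Section LinearCategory.
Variables (k : fieldType) (C : linCat k).
Implicit Types X Y Z W : C.

Lemma compDl X Y Z (g g' : hom Y Z) (f : hom X Y) :
  (g + g') ⊚ f = g ⊚ f + g' ⊚ f.
Proof. by have := comp_linl 1 g g' f; rewrite !scale1r. Qed.

Lemma compDr X Y Z (g : hom Y Z) (f f' : hom X Y) :
  g ⊚ (f + f') = g ⊚ f + g ⊚ f'.
Proof. by have := comp_linr 1 g f f'; rewrite !scale1r. Qed.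

Lemma comp0l X Y Z (f : hom X Y) : (0 : hom Y Z) ⊚ f = 0.
Proof. by rewrite -(subrr (0 : hom Y Z)) compBl subrr. Qed.

Lemma comp0r X Y Z (g : hom Y Z) : g ⊚ (0 : hom X Y) = 0.
Proof. by rewrite -(subrr (0 : hom X Y)) compBr subrr. Qed.

Lemma compNl X Y Z (g : hom Y Z) (f : hom X Y) : (- g) ⊚ f = - (g ⊚ f).
Proof. by rewrite -[- g]sub0r compBl comp0l sub0r. Qed.

Lemma compNr X Y Z (g : hom Y Z) (f : hom X Y) : g ⊚ (- f) = - (g ⊚ f).
Proof. by rewrite -[- f]sub0r compBr comp0r sub0r. Qed.

Lemma compZl X Y Z a (g : hom Y Z) (f : hom X Y) : (a *: g) ⊚ f = a *: (g ⊚ f).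
Proof. by have := comp_linl a g 0 f; rewrite !addr0 comp0l addr0. Qed.

Lemma compZr X Y Z a (g : hom Y Z) (f : hom X Y) : g ⊚ (a *: f) = a *: (g ⊚ f).
Proof. by have := comp_linr a g f 0; rewrite !addr0 comp0r addr0. Qed.

Lemma comp_suml X Y Z I (r : seq I) (F : I -> hom Y Z) (f : hom X Y) :
  (\sum_(i <- r) F i) ⊚ f = \sum_(i <- r) F i ⊚ f.
Proof. by elim/big_rec2: _ => [|i y z _ <-]; rewrite ?comp0l ?compDl. Qed.

Lemma comp_sumr X Y Z I (r : seq I) (F : I -> hom X Y) (g : hom Y Z) :
  g ⊚ (\sum_(i <- r) F i) = \sum_(i <- r) g ⊚ F i.
Proof. by elim/big_rec2: _ => [|i y z _ <-]; rewrite ?comp0r ?compDr. Qed.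

Lemma comp_eq X Y Z W (g : hom Y Z) (f : hom X Y) h (x : hom Z W) :
  g ⊚ f = h -> x ⊚ g ⊚ f = x ⊚ h.
Proof. by move=> <-; rewrite compA. Qed.

Lemma is_iso_id X : is_iso (idm X).
Proof. by exists (idm X); rewrite comp1m. Qed.

Lemma is_iso_comp X Y Z (g : hom Y Z) (f : hom X Y) :
  is_iso g -> is_iso f -> is_iso (g ⊚ f).
Proof.
move=> [g' [g'g gg']] [f' [f'f ff']]; exists (f' ⊚ g').
by rewrite !compA (comp_eq _ g'g) (comp_eq _ ff') !compm1.
Qed.

Lemma is_iso_lr X Y (f : hom X Y) g h : g ⊚ f = idm X -> f ⊚ h = idm Y -> is_iso f.
Proof.
move=> gf fh; exists g; split=> //.
by have -> : g = h by rewrite -[g]compm1 -fh compA gf comp1m.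
Qed.

Lemma is_zero_id X : is_zero X <-> idm X = 0.
Proof.
split=> [[z _]|id0]; first exact: z.
by split=> Y f; [rewrite -[f]compm1 id0 comp0r | rewrite -[f]comp1m id0 comp0l].
Qed.

Lemma is_zero_retract X Y (i : hom X Y) (p : hom Y X) :
  p ⊚ i = idm X -> is_zero Y -> is_zero X.
Proof.
by move=> pi /is_zero_id idY; apply/is_zero_id; rewrite -pi -[p]compm1 idY comp0r comp0l.
Qed.

Lemma local_sum X (f g : hom X X) : local_end X -> is_iso (f + g) -> is_iso f \/ is_iso g.
Proof.
move=> [_ loc] fg; have [?|nf] := pselect (is_iso f); first by left.
by have [?|ng] := pselect (is_iso g); [right | case: (loc _ _ nf ng)].
Qed.

(** One of [e] and [1 - e] is invertible since they sum to the identity, and an invertible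
    idempotent is the identity. *)
Lemma local_idem X (e : hom X X) : local_end X -> e ⊚ e = e -> e = 0 \/ e = idm X.
Proof.
move=> lX ee; have idem_iso (u : hom X X) : u ⊚ u = u -> is_iso u -> u = idm X.
  by move=> uu [v [vu _]]; rewrite -[u]comp1m -{1}vu -compA uu vu.
have [ie|ie] : is_iso e \/ is_iso (idm X - e).
  by apply: local_sum => //; rewrite addrC subrK; apply: is_iso_id.
  by right; apply: idem_iso.
left; have : idm X - e = idm X.
  by apply: idem_iso => //; rewrite compBl !compBr !comp1m compm1 ee subrr subr0.
by rewrite -[RHS]subr0 => /addrI /oppr_inj.
Qed.

Lemma local_split X Y (i : hom X Y) (p : hom Y X) :
  ~ is_zero X -> local_end Y -> p ⊚ i = idm X -> i ⊚ p = idm Y.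
Proof.
move=> nX lY pi; have [|ip0|//] := @local_idem _ (i ⊚ p) lY.
  by rewrite compA (comp_eq _ pi) compm1.
case: nX; apply/is_zero_id.
by rewrite -[idm X]comp1m -{1}pi -{1}pi compA -(compA p i p) ip0 comp0r comp0l.
Qed.

Lemma local_split_iso X Y (i : hom X Y) (p : hom Y X) :
  ~ is_zero X -> local_end Y -> p ⊚ i = idm X -> is_iso i.
Proof. by move=> nX lY pi; exists p; split=> //; apply: local_split. Qed.

End LinearCategory.

(** * Linear functors *)

Section Functoriality.
Variables (k : fieldType) (C D : linCat k) (F : prefunctor C D).
Hypothesis hF : linear_functor F.

Lemma fmap_id (X : C) : fmap F (idm X) = idm (F X).
Proof. by case: hF. Qed.

Lemma fmap_comp (X Y Z : C) (g : hom Y Z) (f : hom X Y) :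
  fmap F (g ⊚ f) = fmap F g ⊚ fmap F f.
Proof. by case: hF. Qed.

Lemma fmapB (X Y : C) (f g : hom X Y) : fmap F (f - g) = fmap F f - fmap F g.
Proof. by case: hF => _ _ l; rewrite addrC -scaleN1r l scaleN1r addrC. Qed.

Lemma fmap0 (X Y : C) : fmap F (0 : hom X Y) = 0.
Proof. by rewrite -(subrr 0) fmapB subrr. Qed.

Lemma fmapN (X Y : C) (f : hom X Y) : fmap F (- f) = - fmap F f.
Proof. by rewrite -[- f]sub0r fmapB fmap0 sub0r. Qed.

Lemma fmapZ (X Y : C) a (f : hom X Y) : fmap F (a *: f) = a *: fmap F f.
Proof. by case: hF => _ _ l; rewrite -[a *: f]addr0 l fmap0 addr0. Qed.

Lemma fmap_zero (X : C) : is_zero X -> is_zero (F X).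
Proof. by move=> /is_zero_id X0; apply/is_zero_id; rewrite -fmap_id X0 fmap0. Qed.

End Functoriality.

(** * Triangulated categories *)

Section LongExactSequences.
Variables (k : fieldType) (C : triCat k).
Hypothesis hT : triangulated C.
Implicit Types X Y Z W : C.

Lemma shift_linear : linear_functor (tshift C).
Proof. by case: hT => [[_ [? _ _] _] _]. Qed.

Definition shift_id := fmap_id shift_linear.
Definition shift_comp := fmap_comp shift_linear.
Definition shift0 := fmap0 shift_linear.
Definition shiftN := fmapN shift_linear.
Definition shiftZ := fmapZ shift_linear.

Lemma shift_full X Y (g : hom X[1] Y[1]) : exists f : hom X Y, f⟦1⟧ = g.
Proof. by case: hT => [[_ [_ /(_ X Y) [h _ hK] _] _] _]; exists (h g). Qed.

Lemma shift_inj X Y (f g : hom X Y) : f⟦1⟧ = g⟦1⟧ -> f = g.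
Proof. by case: hT => [[_ [_ /(_ X Y) /bij_inj inj _] _] _]; apply: inj. Qed.

Lemma shift_eq0 X Y (f : hom X Y) : f⟦1⟧ = 0 -> f = 0.
Proof. by rewrite -(shift0 X Y); apply: shift_inj. Qed.

Lemma shift_esurj Y : exists X, isomorphic X[1] Y.
Proof. by case: hT => [[_ [_ _ h] _] _]. Qed.

Lemma zero_exists : exists O : C, is_zero O.
Proof. by case: hT => [[[? _] _ _] _]. Qed.

Lemma biprod_exists X Y : exists W, biproduct X Y W.
Proof. by case: hT => [[[_ h] _ _] _]. Qed.

Lemma cone_exists X Y (f : hom X Y) : exists Z (g : hom Y Z) h, dist f g h.
Proof. by case: hT => [_ [[_ h] _ _ _]]; apply: h. Qed.

Lemma rotate X Y Z (f : hom X Y) (g : hom Y Z) h :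
  dist f g h <-> dist g h (- f⟦1⟧).
Proof. by case: hT => [_ [_ h' _ _]]; apply: h'. Qed.

Lemma dist_fill X Y Z X' Y' Z' (f : hom X Y) (g : hom Y Z) h
    (f' : hom X' Y') (g' : hom Y' Z') h' u v :
  dist f g h -> dist f' g' h' -> v ⊚ f = f' ⊚ u ->
  exists w : hom Z Z', w ⊚ g = g' ⊚ v /\ u⟦1⟧ ⊚ h = h' ⊚ w.
Proof. by case: hT => [_ [_ _ h3 _]]; apply: h3. Qed.

Lemma dist_id X O : is_zero O -> dist (idm X) (0 : hom X O) 0.
Proof. by case: hT => [_ [[h _] _ _ _]]; apply: h. Qed.

(** The shift is only essentially surjective, so the cone of [g] is replaced by an isomorphic
    [X[1]]; the sign of the rotation is absorbed into [f]. *)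
Lemma cocone_exists Y Z (g : hom Y Z) : exists X (f : hom X Y) h, dist f g h.
Proof.
have [W [h [d dist_ghd]]] := cone_exists g.
have [X [u [v [vu uv]]]] := shift_esurj W.
have [f fE] := shift_full (- (d ⊚ u)).
exists X, f, (v ⊚ h); apply/rotate; rewrite fE opprK.
case: (hT) => [[_ _ /(_ Y Z W Y Z X[1] g h d)] iso_closed _].
apply: (iso_closed _ _ _ (idm Y) (idm Z) v) => //; try exact: is_iso_id.
- by exists u.
- by rewrite comp1m compm1.
- by rewrite compm1.
- by rewrite shift_id comp1m -compA uv compm1.
Qed.

Lemma cocone_conn_exists Z X (h : hom Z X[1]) : exists Y (f : hom X Y) (g : hom Y Z), dist f g h.
Proof.
have [Y [g [d dist_ghd]]] := cocone_exists h.
have [f fE] := shift_full (- d).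
by exists Y, f, g; apply/rotate; rewrite fE opprK.
Qed.

Section Triangle.
Variables (X Y Z : C) (f : hom X Y) (g : hom Y Z) (h : hom Z X[1]).
Hypothesis fgh : dist f g h.

Lemma dist_comp0 : g ⊚ f = 0.
Proof.
have [O O0] := zero_exists.
have [|w [] ] := dist_fill (u := idm X) (v := f) (dist_id X O0) fgh; first by [].
by rewrite comp0r => ->.
Qed.

Lemma dist_ker W (x : hom W Y) : g ⊚ x = 0 -> exists x', x = f ⊚ x'.
Proof.
move=> gx; have [O O0] := zero_exists.
(* Map [W -> 0 -> W[1]] to [Y -> Z -> X[1]]; the map [W[1] -> X[1]] that completes this is a
   shift. *)
have dW := proj1 (rotate _ _ _) (dist_id W O0).
have [|w [_ ]] := dist_fill (u := x) (v := (0 : hom O Z)) dW (proj1 (rotate _ _ _) fgh).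
  by rewrite gx comp0r.
have [x' <-] := shift_full w.
rewrite shift_id compNl compNr compm1 => /oppr_inj.
by rewrite -shift_comp => /shift_inj ->; exists x'.
Qed.

Lemma dist_coker W (x : hom Y W) : x ⊚ f = 0 -> exists x', x = x' ⊚ g.
Proof.
move=> xf; have [O O0] := zero_exists.
have dW : dist (0 : hom O W) (idm W) 0.
  apply/rotate; rewrite shift0 oppr0; apply: dist_id.
  exact: (fmap_zero shift_linear).
have [|w [wg _]] := dist_fill (u := 0) (v := x) fgh dW; first by rewrite xf comp0r.
by exists w; rewrite wg comp1m.
Qed.

End Triangle.

Section Rotations.
Variables (X Y Z : C) (f : hom X Y) (g : hom Y Z) (h : hom Z X[1]).
Hypothesis fgh : dist f g h.

Let ghf := proj1 (rotate _ _ _) fgh.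
Let hfg := proj1 (rotate _ _ _) ghf.

Lemma dist_comp0' : h ⊚ g = 0. Proof. exact: dist_comp0 ghf. Qed.

Lemma dist_comp0'' : f⟦1⟧ ⊚ h = 0.
Proof. by apply/oppr_inj; rewrite -compNl oppr0; apply: dist_comp0 hfg. Qed.

Lemma dist_ker' W (x : hom W Z) : h ⊚ x = 0 -> exists x', x = g ⊚ x'.
Proof. by move=> hx; apply: (dist_ker ghf). Qed.

Lemma dist_ker'' W (x : hom W X[1]) : f⟦1⟧ ⊚ x = 0 -> exists x', x = h ⊚ x'.
Proof. by move=> fx; apply: (dist_ker hfg); rewrite compNl fx oppr0. Qed.

Lemma dist_ker_shift W (x : hom W Y[1]) : g⟦1⟧ ⊚ x = 0 -> exists x', x = f⟦1⟧ ⊚ x'.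
Proof.
move=> gx; have [|x' ->] := dist_ker (proj1 (rotate _ _ _) hfg) (x := x).
  by rewrite compNl gx oppr0.
by exists (- x'); rewrite compNl compNr.
Qed.

Lemma dist_coker' W (x : hom Z W) : x ⊚ g = 0 -> exists x', x = x' ⊚ h.
Proof. by move=> xg; apply: (dist_coker ghf). Qed.

Lemma dist_extend W (x : hom X W) : x⟦1⟧ ⊚ h = 0 -> exists x', x = x' ⊚ f.
Proof.
move=> xh; have [y yE] := dist_coker hfg xh; have [y' y'E] := shift_full y.
exists (- y'); apply: shift_inj.
by rewrite yE -y'E shift_comp shiftN compNl compNr.
Qed.

End Rotations.

(** The cone of a split monomorphism is a complement: [h = r[1] ⊚ u[1] ⊚ h = 0], so [g] has a
    section, which [1 - u r] corrects into one killed by [r]. *)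
Lemma split_mono_complement A X (u : hom A X) (r : hom X A) :
  r ⊚ u = idm A ->
  exists A' (v : hom A' X) (s : hom X A'),
    [/\ s ⊚ v = idm A', s ⊚ u = 0, r ⊚ v = 0 & u ⊚ r + v ⊚ s = idm X].
Proof.
move=> ru; have [A' [g [h dug]]] := cone_exists u.
have h0 : h = 0.
  by rewrite -[h]comp1m -shift_id -ru shift_comp -compA (dist_comp0'' dug) comp0r.
have [s sE] : exists s, idm A' = g ⊚ s by apply: (dist_ker' dug); rewrite h0 comp0l.
have gu := dist_comp0 dug.
(* [1 - s g] factors through [u], which [1 - u r] kills; expanding this gives the sum formula. *)
have e0 : (idm X - u ⊚ r) ⊚ (idm X - s ⊚ g) = 0.
  have [|x ->] := dist_ker dug (x := idm X - s ⊚ g).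
    by rewrite compBr compm1 compA -sE comp1m subrr.
  by rewrite compA compBl comp1m -compA ru compm1 subrr comp0l.
exists A', ((idm X - u ⊚ r) ⊚ s), g; split=> //.
- by rewrite compA compBr compm1 compA gu comp0l subr0 -sE.
- by rewrite compA compBr compm1 compA ru comp1m subrr comp0l.
- move: e0; rewrite compBr compm1 compA => /eqP; rewrite subr_eq0 => /eqP <-.
  by rewrite addrC subrK.
Qed.

End LongExactSequences.

(** * Serre duality *)

Section CalabiYau.
Variables (k : fieldType) (C : triCat k).
Hypotheses (hT : triangulated C) (hCY : calabi_yau2 C).
Implicit Types X Y Z W : C.

(** Serre duality with [S X] identified with [X[2]] through [theta], in the form of a pairing of
    [Hom(X, Y)] with [Hom(Y, X[2])]. *)
Lemma cy_pairing : exists psi : forall X Y, hom X Y -> hom Y X[1][1] -> k,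
  [/\ forall X Y a (f f' : hom X Y) g, psi _ _ (a *: f + f') g = a * psi _ _ f g + psi _ _ f' g,
      forall X Y a (f : hom X Y) g, psi _ _ f (a *: g) = a * psi _ _ f g,
      forall X Y (f : hom X Y), (forall g, psi _ _ f g = 0) -> f = 0
    & forall X Y Y' (b : hom Y Y') (f : hom X Y) g, psi _ _ (b ⊚ f) g = psi _ _ f (g ⊚ b)].
Proof.
have [_ [S [phi [eta [theta [_ [[lin nondeg _] [nat _]] _ _ [isot _ _]]]]]]] := hCY.
pose t X := sval (cid (isot X)).
exists (fun X Y f g => phi X Y f (t X ⊚ g)); split.
- by move=> *; apply: lin.
- by move=> X Y a f g; rewrite compZr linearZ.
- move=> X Y f f0; apply: nondeg => g; have := f0 (theta X ⊚ g).
  by rewrite compA (svalP (cid (isot X))).1 comp1m.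
- by move=> *; rewrite nat compA.
Qed.

Lemma cy_nonzero X Y (f : hom X Y) : f <> 0 -> exists g : hom Y X[1][1], g <> 0.
Proof.
have [psi [_ linr nondeg _]] := cy_pairing => f0; apply: contrapT => noneg.
case: f0; apply: nondeg => g; have -> : g = 0 *: g.
  by rewrite scale0r; apply: contrapT => g0; case: noneg; exists g.
by rewrite linr mul0r.
Qed.

Lemma cy_comp0 X Y Y' (f : hom X Y) (b : hom Y Y') :
  (forall c : hom Y' X[1][1], c ⊚ b = 0) -> b ⊚ f = 0.
Proof.
have [psi [_ linr nondeg nat]] := cy_pairing => cb; apply: nondeg => c.
by rewrite nat cb -(scale0r 0) linr mul0r.
Qed.

(** [Hom(Y, X[1])] is paired with [Hom(X[1], Y[2])], which is [Hom(X, Y[1])] shifted. *)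
Lemma ext1_sym X Y : (forall f : Ext1 X Y, f = 0) -> forall f : Ext1 Y X, f = 0.
Proof.
have [psi [_ linr nondeg _]] := cy_pairing => XY f; apply: nondeg => g.
have [g' <-] := shift_full hT g.
by rewrite (XY g') shift0 // -(scale0r 0) linr mul0r.
Qed.

(** Duality turns surjectivity of [Hom(X', Z) -> Hom(X, Z)] into injectivity of [Hom(Z, X[2]) ->
    Hom(Z, X'[2])]. *)
Lemma shift2_ker0 X X' Z (f : hom X X') :
  (forall u : hom X Z, exists v, u = v ⊚ f) ->
  forall m : hom Z X[1][1], f⟦1⟧⟦1⟧ ⊚ m = 0 -> m = 0.
Proof.
have [psi [lin _ nondeg nat]] := cy_pairing => fZ m fm; apply: nondeg => g.
have [g' <-] := shift_full hT g; have [u <-] := shift_full hT g'.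
have [v ->] := fZ u; rewrite !shift_comp // -nat fm.
have := lin _ _ (-1) 0 0 (v⟦1⟧⟦1⟧); rewrite scaler0 addr0 => ->.
by rewrite mulN1r addNr.
Qed.

(* Serre duality turns proportionality of functionals on a line into
   proportionality of morphisms. *)
Lemma cy_line X Y (h0 : hom Y X[1][1]) (t m : hom X Y) :
  (forall h, exists c, h = c *: h0) -> t <> 0 -> exists c, m = c *: t.
Proof.
have [psi [lin linr nondeg _]] := cy_pairing => line t0.
have psit0 : psi _ _ t h0 != 0.
  apply/eqP => t00; apply: t0; apply: nondeg => h; have [c ->] := line h.
  by rewrite linr t00 mulr0.
exists (psi _ _ m h0 / psi _ _ t h0); apply/eqP; rewrite -subr_eq0 addrC -scaleNr.
apply/eqP; apply: nondeg => h; have [c ->] := line h.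
by rewrite lin !linr mulrCA -mulrDr mulNr divfK // addNr mulr0.
Qed.

End CalabiYau.

(** * Krull-Schmidt decompositions and minimal approximations *)

Section FiniteSpan.
Variables (k : fieldType) (V : lmodType k).

Definition spanned n :=
  exists e : 'I_n -> V, forall v, exists c : 'I_n -> k, v = \sum_(i < n) c i *: e i.

Lemma spanned_dependent n (v : nat -> V) : spanned n ->
  exists c : 'I_n.+1 -> k, (exists i, c i != 0) /\ \sum_(i < n.+1) c i *: v i = 0.
Proof.
move=> [e /(_ (v _))/= he].
have [M vE] := boolp.choice he.
pose A := \matrix_(i < n.+1, j < n) M i j.
have : kermx A != 0.
  rewrite -mxrank_eq0 mxrank_ker subn_eq0 -ltnNge ltnS; exact: rank_leq_col.
case/rowV0Pn => u /sub_kermxP uA u0.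
exists (fun i => u 0 i); split.
  by have [i] := rV0Pn _ u0; exists i.
under eq_bigr => i _ do rewrite vE scaler_sumr.
rewrite exchange_big big1 //= => j _.
under eq_bigr => i _ do rewrite scalerA.
rewrite -scaler_suml; have := congr1 (fun B : 'rV_n => B 0 j) uA.
rewrite !mxE; under eq_bigr => i _ do rewrite mxE.
by move=> ->; rewrite scale0r.
Qed.

End FiniteSpan.

Section Endomorphisms.
Variables (k : fieldType) (C : linCat k).
Hypothesis hfin : hom_finite C.
Implicit Types X Y Z W A E : C.

Definition epow X (f : hom X X) n := iter n (mcomp f) (idm X).

Lemma epowSr X (f : hom X X) n : epow f n.+1 = epow f n ⊚ f.
Proof. by elim: n => [|n IHn]; rewrite /= ?comp1m ?compm1 // -compA -IHn. Qed.

Lemma epow_dependent X (f : hom X X) :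
  exists n (c : 'I_n.+1 -> k), (exists i, c i != 0) /\ \sum_(i < n.+1) c i *: epow f i = 0.
Proof. by have [n sp] := hfin X X; exists n; apply: spanned_dependent sp. Qed.

(** The maps [s ⊚ e i ⊚ v] span [End(A')], and [s ⊚ w ⊚ v = 0] expresses one of them through the
    others. This drop in dimension drives the induction for [left_minimal_version]. *)
Lemma retract_spanned n E A' (v : hom A' E) (s : hom E A') (w : hom E E) :
  spanned (hom E E) n.+1 -> s ⊚ v = idm A' -> w <> 0 -> s ⊚ w ⊚ v = 0 ->
  spanned (hom A' A') n.
Proof.
move=> [e he] sv w0 swv; have [c wE] := he w.
have [l cl] : exists l, c l != 0.
  apply: contrapT => nc; apply: w0; rewrite wE big1 // => i _.
  by have [->|ci] := eqVneq (c i) 0; [rewrite scale0r | case: nc; exists i].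
exists (fun j => s ⊚ e (lift l j) ⊚ v) => x.
have [d xE] := he (v ⊚ x ⊚ s).
(* Subtracting a multiple of [w] clears the coefficient at [l] without changing the compression to
   [A']. *)
pose d' i := d i - d l / c l * c i.
have d'l : d' l = 0 by rewrite /d' divfK // subrr.
exists (fun j => d' (lift l j)).
have -> : x = s ⊚ (\sum_i d' i *: e i) ⊚ v.
  under eq_bigr => i _ do rewrite /d' scalerBl -scalerA.
  rewrite sumrB -scaler_sumr -wE -xE compBr compBl compZr compZl swv scaler0 subr0.
  by rewrite !compA sv comp1m -compA sv compm1.
rewrite comp_sumr comp_suml (bigD1_ord l) //= d'l scale0r comp0r comp0l add0r.
by apply: eq_bigr => j _; rewrite compZr compZl.
Qed.

End Endomorphisms.

(** * Local summands and left minimal maps *)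

Section KrullSchmidt.
Variables (k : fieldType) (C : triCat k).
Hypotheses (hT : triangulated C) (hKS : krull_schmidt C) (hfin : hom_finite C).
Implicit Types X Y Z W A E : C.

(** The Krull-Schmidt decomposition in recursive form, so that local summands can be split off one
    at a time. *)
Inductive sum_of_locals : nat -> C -> Prop :=
| sum_of_locals0 X : is_zero X -> sum_of_locals 0 X
| sum_of_localsS n A X' X :
    local_end A -> sum_of_locals n X' -> biproduct A X' X -> sum_of_locals n.+1 X.

Lemma ks_sum X : exists n, sum_of_locals n X.
Proof.
have [_ /(_ X) [n [A [lA [i [p [pi pi0 ip]]]]]]] := hKS.
exists n; elim: n X A lA i p pi pi0 ip => [|n IHn] X A lA i p pi pi0 ip.
  by apply: sum_of_locals0; apply/is_zero_id; rewrite -ip big_ord0.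
have [X' [v [s [sv su rv us]]]] := split_mono_complement hT (pi ord0).
apply: (@sum_of_localsS _ (A ord0) X'); [exact: lA | | by exists (i ord0), v, (p ord0), s].
have vs : v ⊚ s = idm X - i ord0 ⊚ p ord0 by rewrite -us addrAC subrr add0r.
pose i' j := s ⊚ i (lift ord0 j); pose p' j := p (lift ord0 j) ⊚ v.
have pi' j l : p' j ⊚ i' l = p (lift ord0 j) ⊚ i (lift ord0 l).
  rewrite /p' /i' !compA -(compA _ v s) vs compBr compm1 !compA pi0.
    by rewrite comp0l subr0.
  by move/eqP; rewrite eq_sym (negPf (neq_lift _ _)).
apply: (IHn _ _ _ i' p') => [j|j|j l jl|]; rewrite ?pi' //.
- by apply: pi0 => /lift_inj.
- have := congr1 (fun x => s ⊚ x ⊚ v) ip.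
  rewrite compm1 sv comp_sumr comp_suml big_ord_recl !compA su !comp0l add0r => <-.
  by apply: eq_bigr => j _; rewrite !compA.
Qed.

Lemma nonzero_from_local X W (m : hom X W) : m <> 0 ->
  exists A (i : hom A X) (p : hom X A), [/\ local_end A, p ⊚ i = idm A & m ⊚ i <> 0].
Proof.
have [n Xn] := ks_sum X; elim: Xn W m => [{}X X0|{}n A X' {}X lA _ IH biX] W m.
  by case: X0 => z _ m0; case: m0; apply: z.
have [i [i' [p [p' [pi p'i' pi' p'i ip]]]]] := biX => m0.
have [mi|mi] := pselect (m ⊚ i = 0); last by exists A, i, p.
have mi' : m ⊚ i' <> 0.
  move=> mi'; apply: m0; rewrite -[m]compm1 -ip compDr !compA mi mi' !comp0l.
  exact: addr0.
have [B [j [q [lB qj mj]]]] := IH _ _ mi'.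
by exists B, (i' ⊚ j), (q ⊚ p'); rewrite !compA (comp_eq _ p'i') compm1.
Qed.

Lemma nonzero_to_local X W (m : hom W X) : m <> 0 ->
  exists A (i : hom A X) (p : hom X A), [/\ local_end A, p ⊚ i = idm A & p ⊚ m <> 0].
Proof.
have [n Xn] := ks_sum X; elim: Xn W m => [{}X X0|{}n A X' {}X lA _ IH biX] W m.
  by case: X0 => _ z m0; case: m0; apply: z.
have [i [i' [p [p' [pi p'i' pi' p'i ip]]]]] := biX => m0.
have [mi|mi] := pselect (p ⊚ m = 0); last by exists A, i, p.
have mi' : p' ⊚ m <> 0.
  move=> mi'; apply: m0; rewrite -[m]comp1m -ip compDl -!compA mi mi' !comp0r.
  exact: addr0.
have [B [j [q [lB qj mj]]]] := IH _ _ mi'.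
by exists B, (i' ⊚ j), (q ⊚ p'); rewrite !compA (comp_eq _ p'i') compm1 -compA.
Qed.

(* Gaussian elimination: [p ⊚ g ⊚ i] is invertible, and the Schur complement
   satisfies the same hypothesis. *)
Lemma is_iso_mod_radical E (g : hom E E) :
  (forall A (u : hom A E) (v : hom E A), local_end A -> ~ is_iso (v ⊚ (idm E - g) ⊚ u)) ->
  is_iso g.
Proof.
have [n En] := ks_sum E; elim: En g => [{}E E0|{}n A E' {}E lA _ IH biX] g.
  by move=> _; exists 0; rewrite comp0l comp0r (proj1 (is_zero_id E) E0).
have [i [i' [p [p' [pi p'i' pi' p'i ip]]]]] := biX => rad.
have [b [bg gb]] : is_iso (p ⊚ g ⊚ i).
  have [|//|] := @local_sum _ _ _ (p ⊚ g ⊚ i) (p ⊚ (idm E - g) ⊚ i) lA; last by move/rad.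
  rewrite compBr compBl compm1 pi addrC subrK; exact: is_iso_id.
(* [e1] kills [i], [p] kills [e2], and [g ⊚ e1 = e2 ⊚ g]; the Schur complement is
   [p' ⊚ g ⊚ e1 ⊚ i']. *)
pose e1 := idm E - i ⊚ b ⊚ p ⊚ g; pose e2 := idm E - g ⊚ i ⊚ b ⊚ p.
have e1i : e1 ⊚ i = 0.
  by rewrite compBl comp1m -!compA [p ⊚ _]compA bg compm1 subrr.
have pe2 : p ⊚ e2 = 0.
  by rewrite compBr compm1 !compA gb comp1m subrr.
have ge : g ⊚ e1 = e2 ⊚ g.
  by rewrite compBl compBr compm1 comp1m !compA.
have e1E : e1 = e1 ⊚ i' ⊚ p'.
  by rewrite -{1}[e1]compm1 -ip compDr !compA e1i comp0l add0r.
have e2E : e2 = i' ⊚ p' ⊚ e2.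
  by rewrite -{1}[e2]comp1m -ip compDl -compA pe2 comp0r add0r.
have p'gi : p' ⊚ g ⊚ i = - (p' ⊚ (idm E - g) ⊚ i).
  by rewrite compBr compm1 compBl p'i sub0r opprK.
have [|q [qg gq]] := IH (p' ⊚ g ⊚ e1 ⊚ i').
  move=> B u v lB.
  have -> : v ⊚ (idm E' - p' ⊚ g ⊚ e1 ⊚ i') ⊚ u
     = (v ⊚ p') ⊚ (idm E - g) ⊚ ((i' - i ⊚ b ⊚ p ⊚ g ⊚ i') ⊚ u).
    rewrite !compA -!(compA v); congr (_ ⊚ _); congr (_ ⊚ _).
    rewrite /e1 [RHS]compBr !(compBr, compBl) !compm1 !compA p'i' p'i !comp0l.
    by rewrite !sub0r opprK opprB addrA addrAC.
  exact: (rad _ _ (v ⊚ p') lB).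
have ge1i' : g ⊚ e1 ⊚ i' ⊚ q = i'.
  have -> : g ⊚ e1 = i' ⊚ (p' ⊚ g ⊚ e1) by rewrite -(compA p' g) ge !compA -e2E.
  by rewrite -!compA in gq *; rewrite gq compm1.
apply: (@is_iso_lr _ _ _ _ _ (i ⊚ b ⊚ p + e1 ⊚ i' ⊚ q ⊚ p' ⊚ e2)
                             (i ⊚ b ⊚ p + e1 ⊚ i' ⊚ q ⊚ p' ⊚ e2)).
- rewrite compDl -[X in _ + X]compA -ge {2}e1E !compA -(compA _ p' g) -(compA _ (p' ⊚ g)) .
  rewrite -(compA _ (p' ⊚ g ⊚ e1)) (comp_eq _ qg) compm1 -e1E.
  by rewrite addrC subrK.
- by rewrite compDr !compA ge1i' -e2E addrC subrK.
Qed.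

Definition left_minimal X E (s : hom X E) := forall g : hom E E, g ⊚ s = s -> is_iso g.

(** [1 - i x] fixes [s], so it is invertible; but [x] composed with it is zero, so [x] is zero. *)
Lemma left_minimal_retract X E (s : hom X E) : left_minimal s ->
  forall A (i : hom A E) (x : hom E A), x ⊚ i = idm A -> x ⊚ s = 0 -> is_zero A.
Proof.
move=> ms A i x xi xs.
have [|q [_ gq]] := ms (idm E - i ⊚ x); first by rewrite compBl comp1m -compA xs comp0r subr0.
have : x ⊚ (idm E - i ⊚ x) ⊚ q = 0.
  by rewrite compBr compm1 compA xi comp1m subrr comp0l.
by rewrite -compA gq compm1 => x0; apply/is_zero_id; rewrite -xi x0 comp0l.
Qed.

(** Induction on a bound for the dimension of [End(E)]. If a noninvertible [g] fixes [s], then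
    [1 - g] is outside the radical, so some local retract of [E] has its retraction factoring
    through [1 - g], which kills [s]. Pass to the complement of this retract. *)
Lemma left_minimal_version X E (s : hom X E) :
  exists E' (i : hom E' E) (p : hom E E'),
    [/\ p ⊚ i = idm E', i ⊚ p ⊚ s = s & left_minimal (p ⊚ s)].
Proof.
have [n En] := hfin E E; elim: n E En s => [|n IHn] E En s.
  have E0 : idm E = 0 by case: En => e /(_ (idm E)) [c]; rewrite big_ord0.
  exists E, (idm E), (idm E); rewrite !comp1m; split=> // g _.
  by exists 0; rewrite comp0l comp0r E0.
have [ms|] := pselect (left_minimal s).
  by exists E, (idm E), (idm E); rewrite !comp1m.
move=> /existsNP[g /not_implyP[gs ng]].
have [A [u [v [lA [t [tv vt]]]]]] : exists A (u : hom A E) (v : hom E A),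
    local_end A /\ is_iso (v ⊚ (idm E - g) ⊚ u).
  apply: contrapT => no; apply: ng; apply: is_iso_mod_radical => A u v lA iv.
  by apply: no; exists A, u, v.
pose x := t ⊚ v ⊚ (idm E - g).
have xu : x ⊚ u = idm A by rewrite -tv !compA.
have xs : x ⊚ s = 0 by rewrite /x -compA compBl gs comp1m subrr comp0r.
have [E1 [j [q [qj qu xj uxjq]]]] := split_mono_complement hT xu.
have En1 : spanned (hom E1 E1) n.
  apply: (retract_spanned (w := u ⊚ x) En qj); last by rewrite compA qu !comp0l.
  move=> ux0; case: lA => nA _; apply: nA; apply/is_zero_id.
  by rewrite -[idm A]comp1m -{1}xu -{1}xu compA -(compA x u x) ux0 comp0r comp0l.
have [E' [i [p [pi ips ms]]]] := IHn _ En1 (q ⊚ s).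
exists E', (j ⊚ i), (p ⊚ q); split.
- by rewrite !compA (comp_eq _ qj) compm1.
- rewrite -!compA; move: ips; rewrite -compA => ->.
  by rewrite -[RHS]comp1m -uxjq compDl -(compA u) xs comp0r add0r compA.
- by rewrite -compA.
Qed.

End KrullSchmidt.

(** * Directed cluster-tilting subcategories are hereditary *)

Section Eigenvalue.
Variables (k : closedFieldType) (C : linCat k).
Hypothesis hfin : hom_finite C.
Variable X : C.
Implicit Types (f : hom X X) (p q : {poly k}).

Definition epoly p f := \sum_(i < size p) p`_i *: epow f i.

Lemma epoly_wide n p f : (size p <= n)%N -> epoly p f = \sum_(i < n) p`_i *: epow f i.
Proof.
move=> pn; rewrite /epoly (big_ord_widen n (fun i => p`_i *: epow f i)) // big_mkcond.
apply: eq_bigr => i _; case: ltnP => // pi.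
by rewrite nth_default ?scale0r.
Qed.

Lemma epolyMXsubC p a f : epoly (p * ('X - a%:P)) f = epoly p f ⊚ (f - a *: idm X).
Proof.
have sz : (size (p * ('X - a%:P))%R <= (size p).+1)%N.
  by apply: leq_trans (size_polyMleq p _) _; rewrite size_XsubC addn2.
rewrite (epoly_wide f sz).
have -> : \sum_(i < (size p).+1) (p * ('X - a%:P))`_i *: epow f i =
    \sum_(i < (size p).+1) (p * 'X)`_i *: epow f i -
    a *: \sum_(i < (size p).+1) p`_i *: epow f i.
  rewrite scaler_sumr -sumrB; apply: eq_bigr => i _.
  by rewrite mulrBr coefB coefMC scalerBl scalerA [p`_i * a]mulrC.
rewrite -(@epoly_wide _ p) // big_ord_recl coefMX /= scale0r add0r.
rewrite compBr compZr compm1; congr (_ - _).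
rewrite comp_suml; apply: eq_bigr => i _.
by rewrite coefMX /= compZl -epowSr.
Qed.

(** Descent on the degree of a polynomial annihilating [f]: it has a root [a], and [f - a] is either
    zero or invertible, in which case its factor is cancelled. *)
Lemma endo_scalar : ~ is_zero X -> (forall f, f <> 0 -> is_iso f) ->
  forall f, exists c, f = c *: idm X.
Proof.
move=> X0 div f; have [n [c [[l cl] cf]]] := epow_dependent hfin f.
pose p := \poly_(i < n.+1) (c (inord i)).
have pf : epoly p f = 0.
  rewrite (@epoly_wide n.+1) ?size_poly // -{}[RHS]cf; apply: eq_bigr => i _.
  by rewrite coef_poly ltn_ord inord_val.
have p0 : p != 0.
  apply: contraNneq cl => p0; have := congr1 (fun q : {poly k} => q`_l) p0.
  by rewrite coef_poly ltn_ord inord_val coef0 => ->.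
move: p pf p0 => p; have [m] := ubnP (size p).
elim: m p => // m IHm p; rewrite ltnS => pm pf p0.
have [/eqP/size_poly1P[a a0 pE]|] := eqVneq (size p) 1%N.
  case: X0; apply/is_zero_id; move: pf.
  rewrite /epoly pE size_polyC a0 big_ord_recl big_ord0 addr0 coefC /= => /eqP.
  by rewrite scaler_eq0 (negPf a0) => /eqP.
move=> /closed_rootP[a /factor_theorem[q pE]].
have q0 : q != 0 by apply: contraNneq p0 => q0; rewrite pE q0 mul0r.
have [fa|fa] := pselect (f - a *: idm X = 0).
  by exists a; apply/eqP; rewrite -subr_eq0 fa.
have [g [_ fg]] := div _ fa; apply: (IHm q) => //.
  by apply: leq_trans pm; rewrite pE size_mul ?polyXsubC_eq0 // size_XsubC addn2.
by rewrite -[LHS]compm1 -fg compA -epolyMXsubC -pE pf comp0l.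
Qed.

End Eigenvalue.

(** * Source maps and split kernels *)

Section DirectedClusterTilting.
Variables (k : closedFieldType) (C : triCat k).
Hypotheses (hT : triangulated C) (hCY : calabi_yau2 C) (hKS : krull_schmidt C).
Variable T : subcat C.
Hypotheses (ctT : cluster_tilting T) (dirT : directed (full_sub T)).
Implicit Types X Y Z W A E U V : C.

Let hfin : hom_finite C. Proof. by case: hCY. Qed.

Lemma ct_rigid X Y (f : hom X Y[1]) : T X -> T Y -> f = 0.
Proof. by case: ctT => _ h _ TX /h; apply. Qed.

Lemma ct_mem X : (forall Y, T Y -> forall f : Ext1 Y X, f = 0) -> T X.
Proof. by case: ctT => _ h _ /h. Qed.

Lemma ct_retract X Y (i : hom X Y) (p : hom Y X) : p ⊚ i = idm X -> T Y -> T X.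
Proof.
move=> pi TY; apply: ct_mem => W TW f.
by rewrite -[f]comp1m -shift_id // -pi shift_comp // -compA (ct_rigid (i⟦1⟧ ⊚ f) TW TY) comp0r.
Qed.

Lemma ct_right_approx X :
  exists T0 (p : hom T0 X), T T0 /\ forall W (u : hom W X), T W -> exists v, u = p ⊚ v.
Proof.
have [[h _] _ _] := ctT; have [T0 [p [TT0 ap]]] := h X.
by exists T0, p; split=> // W u /(ap _ u)[v <-]; exists v.
Qed.

Lemma ct_left_approx X :
  exists T0 (p : hom X T0), T T0 /\ forall W (u : hom X W), T W -> exists v, u = v ⊚ p.
Proof.
have [[_ h] _ _] := ctT; have [T0 [p [TT0 ap]]] := h X.
by exists T0, p; split=> // W u /(ap _ u)[v <-]; exists v.
Qed.

(** [T1] lies in [T]: a map from [T] to [T1[1]] dies in [T0[1]], so it comes from a map to [X],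
    which lifts through [p], and [d ⊚ p = 0]. *)
Lemma ct_resolution X : exists T1 T0 (j : hom T1 T0) (p : hom T0 X) (d : hom X T1[1]),
  [/\ T T1, T T0, dist j p d & forall W (u : hom W X), T W -> exists v, u = p ⊚ v].
Proof.
have [T0 [p [TT0 ap]]] := ct_right_approx X.
have [T1 [j [d jpd]]] := cocone_exists hT p.
exists T1, T0, j, p, d; split=> //; apply: ct_mem => W TW f.
have [|x ->] := dist_ker'' hT jpd (x := f); first exact: ct_rigid.
have [v ->] := ap _ x TW.
by rewrite compA (dist_comp0' hT jpd) comp0l.
Qed.

Lemma local_indecomposable X (TX : T X) :
  local_end X -> @indecomposable _ (full_sub T) (exist _ X TX).
Proof.
move=> lX; split=> [/is_zero_id X0|[A TA] [B TB]].
  by case: lX => nX _; apply: nX; apply/is_zero_id.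
move=> [/= i [i' [p [p' [pi p'i' _ _ ip]]]]].
have [|i0|i1] := @local_idem _ _ _ (i ⊚ p) lX.
- by rewrite compA (comp_eq _ pi) compm1.
- left; apply/is_zero_id => /=.
  by rewrite -[idm A]comp1m -{1}pi -{1}pi compA -(compA p i p) i0 comp0r comp0l.
- right; apply/is_zero_id => /=.
  have ip0 : i' ⊚ p' = 0 by apply: (@addrI _ (i ⊚ p)); rewrite ip i1 addr0.
  by rewrite -[idm B]comp1m -{1}p'i' -{1}p'i' compA -(compA p' i' p') ip0 comp0r comp0l.
Qed.
Lemma directed_endo X (f : hom X X) : T X -> local_end X -> f <> 0 -> is_iso f.
Proof.
move=> TX lX f0; apply: contrapT => nf.
case: (dirT (n := 1) (X := fun=> exist _ X TX)); split=> //.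
- by move=> i _; apply: local_indecomposable.
- by exists (idm X); apply: is_iso_id.
- by move=> i _; exists f.
Qed.

Lemma directed_cycle2 A B (f : hom A B) (g : hom B A) :
  T A -> T B -> local_end A -> local_end B ->
  f <> 0 -> g <> 0 -> ~ is_iso f -> ~ is_iso g -> False.
Proof.
move=> TA TB lA lB f0 g0 nf ng.
pose D := full_sub T; pose a : D := exist _ A TA; pose b : D := exist _ B TB.
apply: (dirT (n := 2) (X := fun i => if i is 1%N then b else a)); split=> //.
- by move=> [|[|i]] _; apply: local_indecomposable.
- by exists (idm A); apply: is_iso_id.
- by move=> [|[|//]] _; [exists f | exists g].
Qed.

Lemma directed_cycle3 A B D (f : hom A B) (g : hom B D) (h : hom D A) :
  T A -> T B -> T D -> local_end A -> local_end B -> local_end D ->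
  f <> 0 -> g <> 0 -> h <> 0 -> ~ is_iso f -> ~ is_iso g -> ~ is_iso h -> False.
Proof.
move=> TA TB TD lA lB lD f0 g0 h0 nf ng nh.
pose S := full_sub T.
pose a : S := exist _ A TA; pose b : S := exist _ B TB; pose d : S := exist _ D TD.
apply: (dirT (n := 3) (X := fun i => match i with 1%N => b | 2%N => d | _ => a end)); split=> //.
- by move=> [|[|[|i]]] _; apply: local_indecomposable.
- by exists (idm A); apply: is_iso_id.
- by move=> [|[|[|//]]] _; [exists f | exists g | exists h].
Qed.

Definition split_mono X Y (f : hom X Y) := exists t : hom Y X, t ⊚ f = idm X.

(** The Auslander-Reiten triangle starting at [X]. Its connecting map is obtained from any nonzero
    [d' : X -> X[2]] by desuspending, with [M[1]] isomorphic to [X]. *)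
Lemma almost_split_triangle X : T X -> local_end X ->
  exists Q M (q : hom X Q) (m : hom Q M) (d : hom M X[1]),
  [/\ dist q m d, ~ split_mono q
    & forall V (r : hom X V), T V -> ~ split_mono r -> exists r', r = r' ⊚ q].
Proof.
move=> TX lX; have idX : idm X <> 0 by case: lX => nX _ X0; apply: nX; apply/is_zero_id.
have [d' d'0] := cy_nonzero hCY idX.
have [M [u [w [wu uw]]]] := shift_esurj hT X.
have [d dE] := shift_full hT (d' ⊚ u).
have [Q [q [m qmd]]] := cocone_conn_exists hT d.
exists Q, M, q, m, d; split=> // [[t tq]|V r TV nr].
  have d0 : d = 0.
    by rewrite -[d]comp1m -shift_id // -tq shift_comp // -compA (dist_comp0'' hT qmd) comp0r.
  apply: d'0; rewrite -[d']compm1 -uw compA -dE d0 shift0 //; exact: comp0l.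
apply: (dist_extend hT qmd); apply: (shift_eq0 hT).
(* By duality it suffices that [v ⊚ r = 0] for all [v : V -> X]; a nonzero such endomorphism would
   be invertible and split [r]. *)
rewrite shift_comp // dE compA (cy_comp0 hCY d' (b := r⟦1⟧⟦1⟧)) ?comp0l // => c.
have [c' <-] := shift_full hT c; have [v <-] := shift_full hT c'.
rewrite -!shift_comp //; suff -> : v ⊚ r = 0 by rewrite !shift0.
apply: contrapT => vr; have [t [tvr _]] := directed_endo TX lX vr.
by apply: nr; exists (t ⊚ v); rewrite -compA.
Qed.

(* The exchange triangles [X -> E -> N -> X[1]] and [N -> E2 -> X -> N[1]]: if
   the composite [E -> N -> E2] were nonzero, there would be a cycle
   [X -> A1 -> A2 -> X] through summands of [E] and [E2]. *)
Lemma source_map X : T X -> local_end X -> exists E (s : hom X E),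
  [/\ T E, ~ split_mono s,
      forall V (r : hom X V), T V -> ~ split_mono r -> exists d, r = d ⊚ s
    & forall W (x : hom E W), T W -> x ⊚ s = 0 -> x = 0].
Proof.
move=> TX lX; have [Q [M [q [m [d [qmd nq qr]]]]]] := almost_split_triangle TX lX.
have [nX _] := lX.
have [E0 [e0 [TE0 ae0]]] := ct_left_approx Q.
have [E [i [p [pi ips ms]]]] := left_minimal_version hT hKS hfin (e0 ⊚ q).
set s := p ⊚ (e0 ⊚ q) in ms.
have TE : T E by apply: ct_retract pi TE0.
have ns : ~ split_mono s by move=> [t ts]; apply: nq; exists (t ⊚ p ⊚ e0); rewrite -!compA.
have sr V (r : hom X V) : T V -> ~ split_mono r -> exists d, r = d ⊚ s.
  move=> TV nr; have [r' ->] := qr _ _ TV nr; have [r'' ->] := ae0 _ r' TV.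
  by exists (r'' ⊚ i); rewrite -!(compA r'') [i ⊚ s]compA ips.
exists E, s; split=> //.
have [N [e [n sen]]] := cone_exists hT s.
have n0 : n <> 0.
  move=> n0; apply: ns; have [|t tE] := dist_extend hT sen (x := idm X).
    by rewrite n0 comp0r.
  by exists t.
have homN W (h : hom N W[1]) : T W -> exists v : hom X W, h = v⟦1⟧ ⊚ n.
  move=> TW; have [|x ->] := dist_coker' hT sen (x := h); first exact: ct_rigid.
  by have [v <-] := shift_full hT x; exists v.
have [t1 t10] := cy_nonzero hCY n0.
have [t tE] := shift_full hT t1; have {t10} t0 : t <> 0 by move=> t0; apply: t10; rewrite -tE t0 shift0.
(* [Hom(X, N[1])] is dual to [Hom(N[1], X[2])], which is the line of [n[1]] because the
   endomorphisms of [X] are scalars. *)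
have homXN (y : hom X N[1]) : exists c, y = c *: t.
  apply: (cy_line hCY (h0 := n⟦1⟧)) t0 => h.
  have [h' <-] := shift_full hT h; have [v ->] := homN _ h' TX.
  have [|c ->] := endo_scalar hfin nX _ v; first by move=> f; apply: directed_endo.
  by exists c; rewrite shiftZ // shift_id // compZl comp1m shiftZ.
(* Maps [N -> W[1]] are of the form [v[1] ⊚ n], which is zero when [v] factors through [s]; then
   dualize. *)
have homWN W (y : hom W N[1]) : T W -> (forall v : hom X W, ~ split_mono v) -> y = 0.
  move=> TW nv; apply: contrapT => /(cy_nonzero hCY)[h]; apply.
  have [h' <-] := shift_full hT h; have [v ->] := homN _ h' TW.
  have [d' ->] := sr _ v TW (nv v).
  by rewrite (shift_comp hT d' s) -compA (dist_comp0'' hT sen) comp0r shift0.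
have [E2 [n2 [u n2ut]]] := cocone_conn_exists hT t.
(* On a local summand [A] of [W], a map to [E2[1]] lifts to [N[1]]. The lift is zero unless [A] is
   isomorphic to [X]; then it is a multiple of [t] up to this isomorphism, and [t] dies in
   [E2[1]]. *)
have TE2 : T E2.
  apply: ct_mem => W TW f; apply: contrapT.
  move=> /(nonzero_from_local hT hKS)[A [j [r [lA rj]]]]; apply.
  have TA := ct_retract rj TW.
  have [|y ->] := dist_ker_shift hT n2ut (x := f ⊚ j); first exact: ct_rigid.
  have [[v [w wv]]|nv] := pselect (exists v : hom X A, split_mono v).
    have [c yv] := homXN (y ⊚ v).
    rewrite -[y]compm1 -(local_split nX lA wv) (compA y) yv compZl compZr compA.
    by rewrite (dist_comp0'' hT n2ut) comp0l scaler0.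
  rewrite (homWN A y) ?comp0r // => v sv; by apply: nv; exists v.
have n2e : n2 ⊚ e = 0.
  apply: contrapT => /(nonzero_to_local hT hKS)[A2 [i2 [p2 [lA2 pi2 /(nonzero_from_local hT hKS)]]]].
  move=> [A1 [i1 [p1 [lA1 pi1 x0]]]].
  have TA1 := ct_retract pi1 TE; have TA2 := ct_retract pi2 TE2.
  have ps0 : p1 ⊚ s <> 0 by move=> ps0; case: lA1 => nA1; case: nA1; apply: left_minimal_retract ms _ _ _ pi1 ps0.
  have nps : ~ is_iso (p1 ⊚ s) by move=> [w [wps _]]; apply: ns; exists (w ⊚ p1); rewrite -compA.
  (* Otherwise [i2] factors through [n2 ⊚ e], and [A2] is a retract of [E] whose retraction kills
     [s], against minimality. *)
  have ui0 : u ⊚ i2 <> 0.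
    move=> /(dist_ker hT n2ut)[s2 i2E].
    have [|s3 s2E] := dist_ker' hT sen (x := s2); first exact: ct_rigid.
    case: lA2 => nA2; case: nA2; apply: (left_minimal_retract ms (i := s3) (x := p2 ⊚ (n2 ⊚ e))).
      by rewrite -!compA -s2E -i2E.
    by rewrite -!compA (dist_comp0 hT sen) !comp0r.
  have nui : ~ is_iso (u ⊚ i2).
    move=> [w [_ uiw]]; apply: t0.
    by rewrite -[t]compm1 -uiw !compA (dist_comp0' hT n2ut) !comp0l.
  have [x_iso|nx] := pselect (is_iso (p2 ⊚ (n2 ⊚ e) ⊚ i1)); last first.
    exact: directed_cycle3 TX TA1 TA2 lX lA1 lA2 ps0 x0 ui0 nps nx nui.
  (* An invertible [A1 -> A2] is absorbed into [u ⊚ i2], leaving a cycle of length two. *)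
  set x := _ ⊚ i1 in x0 x_iso; have [w [wx xw]] := x_iso.
  apply: (directed_cycle2 TX TA1 lX lA1 ps0 (g := u ⊚ i2 ⊚ x)) => //.
    by move=> uix; apply: ui0; rewrite -[u ⊚ i2]compm1 -xw compA uix comp0l.
  move=> uix; apply: nui; rewrite -[u ⊚ i2]compm1 -xw compA; apply: is_iso_comp => //.
  by exists x.
(* A map killing [s] factors through [e] and, by rigidity, through [n2 ⊚ e = 0]. *)
move=> W x TW /(dist_coker hT sen)[y ->].
have [|y' ->] := dist_extend hT n2ut (x := y); first exact: ct_rigid.
by rewrite -compA n2e comp0r.
Qed.

Definition weak_kernel K U V (g : hom U V) (c : hom K U) :=
  g ⊚ c = 0 /\ forall W (x : hom W U), T W -> g ⊚ x = 0 -> exists y, x = c ⊚ y.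

Lemma weak_kernel_exists U V (g : hom U V) :
  exists K (c : hom K U), T K /\ weak_kernel g c.
Proof.
have [N [a [h agh]]] := cocone_exists hT g.
have [K [b [TK bK]]] := ct_right_approx N.
exists K, (a ⊚ b); split=> //; split=> [|W x TW /(dist_ker hT agh)[y ->]].
  by rewrite compA (dist_comp0 hT agh) comp0l.
by have [v ->] := bK _ y TW; exists v; rewrite compA.
Qed.

(* That is, [T] is hereditary. *)
Lemma kernel_splits U V (g : hom U V) : T U -> T V ->
  exists r : hom U U, g ⊚ r = 0 /\
    forall W (x : hom W U), T W -> g ⊚ x = 0 -> r ⊚ x = x.
Proof.
move=> TU TV; have [K [c [TK kc]]] := weak_kernel_exists g.
have [n Kn] := ks_sum hT hKS K.
(* Induction on the number of local summands of a weak kernel, for all [U] and [g] at once. *)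
elim: Kn U g c TU TK kc => [{}K K0|{}n A K' {}K lA _ IH bK] U g c TU TK [gc gK].
  exists 0; split=> [|W x TW /(gK W x TW)[y ->]]; first exact: comp0r.
  by case: K0 => z _; rewrite (z _ c) !comp0l.
have [i [i' [p [p' [pi p'i' pi' p'i ip]]]]] := bK.
have TA := ct_retract pi TK; have TK' := ct_retract p'i' TK.
(* If [c ⊚ i] splits, [A] is a summand of [U] killed by [g], and the complement [U'] has the weak
   kernel [s ⊚ c ⊚ i']. *)
have [[r rci]|nci] := pselect (split_mono (c ⊚ i)).
  have [U' [v [s [sv su rv us]]]] := split_mono_complement hT rci.
  have TU' := ct_retract sv TU.
  have [|r' [gr' rx']] := IH _ (g ⊚ v) (s ⊚ c ⊚ i') TU' TK'.
    split=> [|W x TW gvx].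
      have -> : g ⊚ v ⊚ (s ⊚ c ⊚ i') = g ⊚ (v ⊚ s) ⊚ c ⊚ i' by rewrite !compA.
      have -> : v ⊚ s = idm U - c ⊚ i ⊚ r by rewrite -us addrAC subrr add0r.
      by rewrite compBr compBl !compA compm1 gc !comp0l subrr comp0l.
    have [|y vx] := gK _ (v ⊚ x) TW; first by rewrite compA.
    exists (p' ⊚ y); rewrite -[x]comp1m -sv -compA vx -{1}[y]comp1m -ip compDl !compDr.
    by rewrite !compA -(compA s) su !comp0l add0r.
  exists (c ⊚ i ⊚ r + v ⊚ r' ⊚ s); split=> [|W x TW gx].
    by rewrite compDr !compA gc gr' !comp0l addr0.
  have vs : v ⊚ s = idm U - c ⊚ i ⊚ r by rewrite -us addrAC subrr add0r.
  rewrite compDl -!(compA v) -(compA r') rx' //.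
    by rewrite compA vs compBl comp1m addrC subrK.
  by rewrite compA -(compA g) vs compBr compBl compm1 !compA gc !comp0l subr0 gx.
(* Otherwise [A] is redundant. Since [c ⊚ i = d ⊚ s] and [s] is epic for maps to [T], [g ⊚ d = 0]
   and [d = c ⊚ y]. So [c] kills [i - y ⊚ s], whose [A]-component is invertible and serves to clear
   that component of any lift. *)
apply: (IH _ g (c ⊚ i')) => //; split=> [|W x TW gx]; first by rewrite compA gc comp0l.
have [E [s [TE ns sr s0]]] := source_map TA lA.
have [d ciE] := sr _ _ TU nci.
have [|y dE] := gK _ d TE.
  by apply: s0 => //; rewrite -compA -ciE compA gc comp0l.
have cj : c ⊚ (i - y ⊚ s) = 0 by rewrite compBr compA -dE -ciE subrr.
have [b [_ pjb]] : is_iso (p ⊚ (i - y ⊚ s)).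
  have [|[t [tpys _]]|//] := @local_sum _ _ _ (p ⊚ (y ⊚ s)) (p ⊚ (i - y ⊚ s)) lA.
    rewrite -compDr addrC subrK pi; exact: is_iso_id.
  by case: ns; exists (t ⊚ p ⊚ y); rewrite -!compA.
have [v xE] := gK _ x TW gx.
pose v' := v - (i - y ⊚ s) ⊚ b ⊚ p ⊚ v.
have pv' : p ⊚ v' = 0 by rewrite compBr !compA pjb comp1m subrr.
exists (p' ⊚ v'); rewrite xE.
have -> : c ⊚ v = c ⊚ v' by rewrite compBr !compA cj !comp0l subr0.
by rewrite -{1}[v']comp1m -ip compDl -!compA pv' comp0r add0r.
Qed.

End DirectedClusterTilting.

(** * The Bongartz completion *)

Section ModuloZ.
Variables (k : fieldType) (C : linCat k) (Z : subcat C).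
Implicit Types X Y W : C.

Definition modZ X Y (f : hom X Y) : @hom _ (quot_cat (factor_ideal Z)) X Y :=
  qpi (factor_ideal Z X Y) f.

Lemma modZ_comp X Y W (g : hom Y W) (f : hom X Y) : modZ (g ⊚ f) = modZ g ⊚ modZ f.
Proof. by symmetry; apply: qcompE. Qed.

Lemma modZ_id X : modZ (idm X) = idm _.
Proof. by []. Qed.

Lemma modZD X Y (f g : hom X Y) : modZ (f + g) = modZ f + modZ g.
Proof. exact: qpiD. Qed.

Lemma modZP X Y (f g : hom X Y) : modZ f = modZ g <-> factors Z (f - g).
Proof. exact: qpiP. Qed.

Lemma modZB X Y (f g : hom X Y) : modZ (f - g) = modZ f - modZ g.
Proof. by apply/eqP; rewrite eq_sym subr_eq -modZD subrK. Qed.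

Lemma modZZ X Y a (f : hom X Y) : modZ (a *: f) = a *: modZ f.
Proof. by symmetry; apply: qscaleE. Qed.

Lemma modZ0 X Y : modZ (0 : hom X Y) = 0.
Proof. by rewrite -(subrr 0) modZB subrr. Qed.

Lemma modZ_eq0 X Y (f : hom X Y) : modZ f = 0 <-> factors Z f.
Proof. by rewrite -modZ0 modZP subr0. Qed.

Lemma modZ_surj X Y (x : @hom _ (quot_cat (factor_ideal Z)) X Y) : exists f, modZ f = x.
Proof. exact: qpi_surj. Qed.

Lemma modZ_through X Y W (a : hom X W) (b : hom W Y) : Z W -> modZ (b ⊚ a) = 0.
Proof. by move=> ZW; apply/modZ_eq0; exists W, a, b. Qed.

End ModuloZ.

(** * Bongartz objects, the completion and its kernels modulo [Z] *)

Section BongartzCompletion.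
Variables (k : closedFieldType) (C : triCat k).
Hypotheses (hT : triangulated C) (hCY : calabi_yau2 C) (hKS : krull_schmidt C).
Variables (T Z : subcat C).
Hypotheses (ctT : cluster_tilting T) (ffZ : functorially_finite Z) (rigZ : rigid Z).
Implicit Types X Y W A B E U V : C.

Local Notation π f := (modZ Z f).

Lemma perp1Z X : Z X -> perp1 Z X.
Proof. by move=> ZX Y ZY f; apply: rigZ. Qed.

Lemma perp1_ext X W (f : hom X W[1]) : perp1 Z X -> Z W -> f = 0.
Proof. by move=> pX ZW; apply: (ext1_sym hT hCY) => g; apply: pX. Qed.

Lemma right_approxZ X :
  exists Z0 (p : hom Z0 X), Z Z0 /\ forall W (u : hom W X), Z W -> exists v, u = p ⊚ v.
Proof.
have [h _] := ffZ; have [Z0 [p [ZZ0 ap]]] := h X.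
by exists Z0, p; split=> // W u /(ap _ u)[v <-]; exists v.
Qed.

Definition bongartz X B Z0 (i : hom X B) (q : hom B Z0) (d : hom Z0 X[1]) :=
  [/\ T X, Z Z0, dist i q d & forall W (u : hom W X[1]), Z W -> exists v, u = d ⊚ v].

Definition bongartz_object B := exists X Z0 i q d, @bongartz X B Z0 i q d.

Lemma bongartz_exists X : T X -> exists B Z0 i q d, @bongartz X B Z0 i q d.
Proof.
move=> TX; have [Z0 [d [ZZ0 ad]]] := right_approxZ X[1].
by have [B [i [q iqd]]] := cocone_conn_exists hT d; exists B, Z0, i, q, d.
Qed.

Section OneObject.
Variables (X B Z0 : C) (i : hom X B) (q : hom B Z0) (d : hom Z0 X[1]).
Hypothesis bonB : bongartz i q d.

Lemma bongartz_perp1 : perp1 Z B.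
Proof.
have [TX ZZ0 iqd ad] := bonB => W ZW f.
have [|m ->] := dist_ker_shift hT iqd (x := f); first exact: rigZ.
by have [v ->] := ad _ m ZW; rewrite compA (dist_comp0'' hT iqd) comp0l.
Qed.

Lemma bongartz_extend Y (x : hom X Y) : perp1 Z Y -> exists x', x = x' ⊚ i.
Proof.
have [TX ZZ0 iqd ad] := bonB => pY.
by apply: (dist_extend hT iqd); apply: pY.
Qed.

(** Thus [i] is epic modulo [Z]: if [x ⊚ i] factors through [Z2], its half [X -> Z2] extends to [B],
    and what remains of [x] factors through [Z0]. *)
Lemma bongartz_cancel Y (x : hom B Y) : π (x ⊚ i) = 0 -> π x = 0.
Proof.
have [TX ZZ0 iqd ad] := bonB.
move/modZ_eq0 => [Z2 [u [v [ZZ2 vu]]]].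
have [u' uE] := bongartz_extend u (perp1Z ZZ2).
have [|y yE] := dist_coker hT iqd (x := x - v ⊚ u').
  by rewrite compBl -vu -compA -uE subrr.
by rewrite -[x](subrK (v ⊚ u')) yE modZD !modZ_through // addr0.
Qed.

End OneObject.

(** [f] lifts to a map [B -> X'[1]], which vanishes on [X] by rigidity of [T]; so it factors through
    [q], then through [d'], and [i'[1]] kills [d']. *)
Lemma bongartz_rigid X B Z0 i q d B' (f : hom B B'[1]) :
  @bongartz X B Z0 i q d -> bongartz_object B' -> f = 0.
Proof.
move=> bonB [X' [Z0' [i' [q' [d' bonB']]]]].
have [TX ZZ0 iqd ad] := bonB; have [TX' ZZ0' iqd' ad'] := bonB'.
have [|m ->] := dist_ker_shift hT iqd' (x := f).
  exact: perp1_ext (bongartz_perp1 bonB) ZZ0'.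
have [|y ->] := dist_coker hT iqd (x := m); first exact: (ct_rigid ctT).
have [v ->] := ad' _ y ZZ0.
by rewrite !compA (dist_comp0'' hT iqd') !comp0l.
Qed.

Definition completion X := perp1 Z X /\ forall B, bongartz_object B -> forall f : hom B X[1], f = 0.

Lemma completionZ X : Z X -> completion X.
Proof.
move=> ZX; split=> [|B [Y [Z0 [i [q [d bonB]]]]] f]; first exact: perp1Z.
exact: perp1_ext (bongartz_perp1 bonB) ZX.
Qed.

Lemma completion_bongartz B : bongartz_object B -> completion B.
Proof.
move=> bonB; have [X [Z0 [i [q [d bonX]]]]] := bonB.
split=> [|B' [X' [Z0' [i' [q' [d' bonB']]]]] f]; first exact: bongartz_perp1 bonX.
exact: bongartz_rigid bonB' bonB.
Qed.

(** Extend a [T]-resolution of [X] to Bongartz objects. As [f ⊚ p' = 0], [f] factors through [i1[1]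
    ⊚ d : X -> B1[1]], which is zero by the symmetry of [Ext1]. *)
Lemma completion_ext X Y (f : hom X Y[1]) : completion X -> completion Y -> f = 0.
Proof.
move=> [pX eX] [pY eY].
have [T1 [T0 [j [p [d [TT1 TT0 jpd _]]]]]] := ct_resolution hT ctT X.
have [B0 [Z0 [i0 [q0 [d0 bon0]]]]] := bongartz_exists TT0.
have [B1 [Z1 [i1 [q1 [d1 bon1]]]]] := bongartz_exists TT1.
have [p' pE] := bongartz_extend bon0 p pX.
have fp' : f ⊚ p' = 0 by apply: eY; exists T0, Z0, i0, q0, d0.
have [|y ->] := dist_coker' hT jpd (x := f); first by rewrite pE compA fp' comp0l.
have [y0 <-] := shift_full hT y; have [y1 ->] := bongartz_extend bon1 y0 pY.
rewrite shift_comp // -compA [i1⟦1⟧ ⊚ d](_ : _ = 0) ?comp0r //.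
apply: (ext1_sym hT hCY) => g; apply: eX; by exists T1, Z1, i1, q1, d1.
Qed.

Lemma completion_mem X : (forall Y, completion Y -> forall f : hom Y X[1], f = 0) -> completion X.
Proof.
move=> eX; split=> [W ZW f|B bonB f]; apply: eX; first exact: completionZ.
exact: completion_bongartz.
Qed.

Lemma completion_retract X Y (i : hom X Y) (p : hom Y X) :
  p ⊚ i = idm X -> completion Y -> completion X.
Proof.
move=> pi cY; apply: completion_mem => W cW f.
by rewrite -[f]comp1m -shift_id // -pi shift_comp // -compA (completion_ext (i⟦1⟧ ⊚ f) cW cY) comp0r.
Qed.

Lemma completion_biproduct X Y W : completion X -> completion Y -> biproduct X Y W -> completion W.
Proof.
move=> cX cY [i [i' [p [p' [_ _ _ _ ip]]]]]; apply: completion_mem => V cV f.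
have e : i⟦1⟧ ⊚ p⟦1⟧ + i'⟦1⟧ ⊚ p'⟦1⟧ = idm W[1].
  have [[_ [[_ _ lin] _ _] _] _] := hT.
  by rewrite -!shift_comp // -shift_id // -ip -[i ⊚ p]scale1r lin !scale1r.
rewrite -[f]comp1m -e compDl -!compA.
by rewrite (completion_ext (p⟦1⟧ ⊚ f)) // (completion_ext (p'⟦1⟧ ⊚ f)) // !comp0r addr0.
Qed.

(** [P] is the sum of the Bongartz object of a [T]-cover of [X] and a [Z]-cover of [X]. Maps from
    Bongartz objects and from [Z] lift to [P], which puts [Y] in the completion. *)
Lemma completion_resolution X : perp1 Z X ->
  exists Y P (y : hom Y P) (t : hom P X) h B Z1 (iB : hom B P) (iZ : hom Z1 P) pB pZ,
  [/\ dist y t h, completion Y, completion P,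
      forall W (u : hom W X), completion W -> exists v, u = t ⊚ v
    & [/\ bongartz_object B, Z Z1 & iB ⊚ pB + iZ ⊚ pZ = idm P]].
Proof.
move=> pX; have [T1 [T0 [j [p [d [TT1 TT0 jpd ap]]]]]] := ct_resolution hT ctT X.
have [B [Z0 [i0 [q0 [d0 bon0]]]]] := bongartz_exists TT0.
have [b pE] := bongartz_extend bon0 p pX.
have [Z1 [z [ZZ1 az]]] := right_approxZ X.
have [P biP] := biprod_exists hT B Z1.
have [iB [iZ [pB [pZ [pBiB pZiZ pBiZ pZiB ip]]]]] := biP.
have bonB : bongartz_object B by exists T0, Z0, i0, q0, d0.
have cP : completion P by apply: completion_biproduct biP; [apply: completion_bongartz | apply: completionZ].
pose t := b ⊚ pB + z ⊚ pZ.
have tB : t ⊚ iB = b by rewrite compDl -!compA pBiB pZiB comp0r compm1 addr0.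
have tZ : t ⊚ iZ = z by rewrite compDl -!compA pBiZ pZiZ comp0r compm1 add0r.
have [Y [y [h yth]]] := cocone_exists hT t.
have tapZ W (u : hom W X) : Z W -> exists v, u = t ⊚ v.
  by move=> /(az _ u)[v ->]; exists (iZ ⊚ v); rewrite compA tZ.
have tapB W (u : hom W X) : bongartz_object W -> exists v, u = t ⊚ v.
  move=> [X' [Z0' [i' [q' [d' bon']]]]]; have [TX' ZZ0' iqd' _] := bon'.
  (* Lift over [X'] first; the error factors through [q'] and lifts through the [Z]-cover. *)
  have [s sE] := ap _ (u ⊚ i') TX'.
  have [e eE] := bongartz_extend bon' (i0 ⊚ s) (bongartz_perp1 bon0).
  have [|m mE] := dist_coker hT iqd' (x := u - b ⊚ e).
    by rewrite compBl sE pE -!compA eE subrr.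
  have [v mE'] := az _ m ZZ0'.
  exists (iB ⊚ e + iZ ⊚ v ⊚ q').
  by rewrite compDr !compA tB tZ -mE' -mE addrC subrK.
have extY W (f : hom W Y[1]) : completion W -> (forall u : hom W X, exists v, u = t ⊚ v) -> f = 0.
  move=> cW tap; have [|m ->] := dist_ker'' hT yth (x := f); first exact: completion_ext.
  by have [v ->] := tap m; rewrite compA (dist_comp0' hT yth) comp0l.
have cY : completion Y.
  split=> [W ZW f|W bonW f]; apply: extY => [|u].
  - exact: completionZ.
  - exact: tapZ.
  - exact: completion_bongartz.
  - exact: tapB.
exists Y, P, y, t, h, B, Z1, iB, iZ, pB, pZ; split=> // W u cW.
by apply: (dist_ker' hT yth); apply: completion_ext.
Qed.

Lemma completion_mod_retract X : completion X ->
  exists B (s : hom X B) (b : hom B X), bongartz_object B /\ π b ⊚ π s = idm _.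
Proof.
move=> cX; have [Y [P [y [t [h [B [Z1 [iB [iZ [pB [pZ]]]]]]]]]]] := completion_resolution cX.1.
move=> [yth cY cP ap [bonB ZZ1 ip]].
have [s idE] := ap _ (idm X) cX.
exists B, (pB ⊚ s), (t ⊚ iB); split=> //.
rewrite -modZ_comp -modZ_id idE -{2}[s]comp1m -ip compDl compDr modZD !compA.
by rewrite -[t ⊚ iZ ⊚ _ ⊚ _]compA (modZ_through _ _ ZZ1) addr0.
Qed.

(** [G] is the extension of [P] by [X] pulled back from the given triangle along an approximation
    [t : P -> X1]. *)
Lemma completion_left_approx X X' X1 (a : hom X X') (b : hom X' X1) (c : hom X1 X[1]) :
  dist a b c -> completion X' -> perp1 Z X1 ->
  exists G (g : hom X G), completion G /\ forall W (u : hom X W), completion W -> exists v, u = v ⊚ g.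
Proof.
move=> abc cX' pX1.
have [Y [P [y [t [h [B [Z1 [iB [iZ [pB [pZ]]]]]]]]]]] := completion_resolution pX1.
move=> [_ _ cP ap _].
have [G [g [g' ggc]]] := cocone_conn_exists hT (c ⊚ t).
exists G, g; split=> [|W u cW].
  apply: completion_mem => W cW f.
  have [|m ->] := dist_ker_shift hT ggc (x := f); first exact: completion_ext.
  have [|m' ->] := dist_ker'' hT abc (x := m); first exact: completion_ext.
  have [v ->] := ap _ m' cW.
  by rewrite [c ⊚ _]compA compA (dist_comp0'' hT ggc) comp0l.
by apply: (dist_extend hT ggc); apply: completion_ext.
Qed.

Hypothesis dirT : directed (full_sub T).

(* [E] = ([T0] + [B]) / [A] would be an extension of [B'] by the kernel of [f];
   [a] being split by [kernel_splits], the section of [E -> B'] given by the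
   universal property of [B'] amounts to the choice of [b'] below. *)
Lemma bongartz_kernel_presentation X' B' Z0' i' q' d' B (f : hom B B') :
  @bongartz X' B' Z0' i' q' d' -> bongartz_object B ->
  exists T0 (p : hom T0 B') A (a : hom A T0) (b' : hom A B),
  [/\ forall W (u : hom W B'), T W -> exists v, u = p ⊚ v,
      forall W (w : hom W A), T W -> π (f ⊚ b' ⊚ w) = π (p ⊚ a ⊚ w),
      forall W (q0 : hom W T0) (b : hom W B), T W -> π (p ⊚ q0) = π (f ⊚ b) ->
        exists w, q0 = a ⊚ w
    & forall W (w : hom W A), T W -> π (p ⊚ a ⊚ w) = 0 -> π (b' ⊚ w) = 0].
Proof.
move=> bon' bonB; have [TX' ZZ0' iqd' _] := bon'.
have bonB' : bongartz_object B' by exists X', Z0', i', q', d'.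
have pB : perp1 Z B by case: (completion_bongartz bonB).
have pB' := bongartz_perp1 bon'.
have [T1 [T0 [j [p [e [TT1 TT0 jpe ap]]]]]] := ct_resolution hT ctT B'.
have [Z1 [z [ZZ1 az]]] := right_approxZ B'.
(* A map into [B'] is zero modulo [Z] exactly when [k1] kills it. *)
have [D1 [k1 [l1 zkl]]] := cone_exists hT z.
have [D2 [k2 [l2 fkl]]] := cone_exists hT (k1 ⊚ f).
(* [A] covers the pullback of [p] and [f] modulo [Z]. *)
have [A [a [TA [ka0 kau]]]] := weak_kernel_exists hT ctT (k2 ⊚ k1 ⊚ p).
have [b1 paE] : exists b1, k1 ⊚ p ⊚ a = k1 ⊚ f ⊚ b1.
  by apply: (dist_ker hT fkl); rewrite !compA.
have pafb1 : π (p ⊚ a) = π (f ⊚ b1).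
  have [|m mE] := dist_ker hT zkl (x := p ⊚ a - f ⊚ b1).
    by rewrite compBr !compA paE subrr.
  by apply/modZP; rewrite mE; apply/modZ_eq0; rewrite modZ_through.
have univ W (q0 : hom W T0) (b : hom W B) : T W -> π (p ⊚ q0) = π (f ⊚ b) ->
    exists w, q0 = a ⊚ w.
  move=> TW /modZP[Z2 [u [v [ZZ2 vu]]]]; apply: kau => //.
  have [v' vE] := az _ v ZZ2.
  have : k1 ⊚ (p ⊚ q0 - f ⊚ b) = 0.
    by rewrite -vu vE !compA (dist_comp0 hT zkl) !comp0l.
  rewrite compBr => /eqP; rewrite subr_eq0 -!(compA k2) -(compA k1) => /eqP ->.
  by rewrite !compA -(compA k2) (dist_comp0 hT fkl) comp0l.
have [r [ar rx]] := kernel_splits hT hCY hKS ctT dirT a TA TT0.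
pose bA := b1 ⊚ (idm A - r).
have pafbA : π (p ⊚ a) = π (f ⊚ bA).
  rewrite /bA compA [RHS]modZ_comp -pafb1 -modZ_comp compBr compm1 -compA ar.
  by rewrite comp0r subr0.
have bA0 W (x : hom W A) : T W -> a ⊚ x = 0 -> bA ⊚ x = 0.
  by move=> TW ax; rewrite -compA compBl comp1m (rx _ _ TW ax) subrr comp0r.
have pj := dist_comp0 hT jpe.
have [wj jE] : exists wj, j = a ⊚ wj.
  by apply: (univ _ j 0) => //; rewrite pj comp0r.
have [g0 g0E] : exists g0, bA ⊚ wj = g0 ⊚ j.
  by apply: (dist_extend hT jpe); apply: bongartz_rigid bon' bonB.
have [t tE] := ap _ i' TX'.
have [g gE] := bongartz_extend bon' (g0 ⊚ t) pB.
(* [c] agrees with [g0] on [j] and vanishes on the lift [t] of [i']; the latter makes [f ⊚ c] zero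
   modulo [Z]. *)
pose c := g0 - g ⊚ p.
have cj : c ⊚ j = bA ⊚ wj by rewrite compBl -compA pj comp0r subr0.
have ct0 : c ⊚ t = 0 by rewrite compBl -compA -tE gE subrr.
have fc0 : π (f ⊚ c) = 0.
  have : π (f ⊚ c ⊚ j) = 0.
    by rewrite -compA cj compA modZ_comp -pafbA -modZ_comp -compA -jE pj modZ0.
  move/modZ_eq0 => [Z2 [u [v [ZZ2 vu]]]].
  have [u' uE] : exists u', u = u' ⊚ j.
    by apply: (dist_extend hT jpe); apply: perp1_ext.
  have [|y yE] := dist_coker hT jpe (x := f ⊚ c - v ⊚ u').
    by rewrite compBl -vu -(compA v) -uE subrr.
  have y0 : π y = 0.
    apply: (bongartz_cancel bon'); rewrite tE compA -yE compBl -compA ct0 comp0r.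
    by rewrite -compA modZB modZ0 modZ_through // subrr.
  have -> : f ⊚ c = y ⊚ p + v ⊚ u' by rewrite -yE subrK.
  by rewrite modZD modZ_comp y0 comp0l add0r modZ_through.
(* The correction kills [wj], the part of [A] over the kernel of [p]. *)
pose b' := bA - c ⊚ a.
have b'0 W (x : hom W A) : T W -> a ⊚ x = 0 -> b' ⊚ x = 0.
  by move=> TW ax; rewrite compBl bA0 // -compA ax comp0r subrr.
have b'wj : b' ⊚ wj = 0 by rewrite compBl -compA -jE cj subrr.
exists T0, p, A, a, b'; split=> // W w TW.
  rewrite modZ_comp [RHS]modZ_comp; congr (_ ⊚ _).
  by rewrite compBr modZB -pafbA compA [π (f ⊚ c ⊚ a)]modZ_comp fc0 comp0l subr0.
(* Cover [Z2] by [S0] in [T]. On the resulting [w2] the map [b'] is zero modulo [Z], and the rest of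
   [w] lies over the kernel of [p]. *)
move=> /modZ_eq0[Z2 [u [v [ZZ2 vu]]]].
have [S1 [S0 [s [p2 [e2 [TS1 TS0 sp2 ap2]]]]]] := ct_resolution hT ctT Z2.
have [u' uE] := ap2 _ u TW.
have [q2 q2E] := ap _ (v ⊚ p2) TS0.
have [w2 w2E] : exists w2, q2 = a ⊚ w2.
  by apply: (univ _ q2 0) => //; rewrite -q2E comp0r modZ_through // modZ0.
have [u2 u2E] : exists u2, q2 ⊚ s = j ⊚ u2.
  apply: (dist_ker hT jpe); rewrite compA -q2E -compA (dist_comp0 hT sp2); exact: comp0r.
have b'w2 : π (b' ⊚ w2) = 0.
  have [|y ->] := dist_coker hT sp2 (x := b' ⊚ w2); last by rewrite modZ_through.
  have /b'0 : a ⊚ (w2 ⊚ s - wj ⊚ u2) = 0.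
    by rewrite compBr !compA -w2E -jE u2E subrr.
  by move/(_ TS1); rewrite compBr !compA b'wj comp0l subr0.
have [u3 u3E] : exists u3, a ⊚ w - q2 ⊚ u' = j ⊚ u3.
  by apply: (dist_ker hT jpe); rewrite compBr !compA -q2E -vu -compA -uE subrr.
have /b'0 : a ⊚ (w - w2 ⊚ u' - wj ⊚ u3) = 0.
  by rewrite !compBr !compA -w2E -jE u3E subrr.
move/(_ TW); rewrite !compBr !compA b'wj comp0l subr0 => /eqP; rewrite subr_eq0 => /eqP ->.
by rewrite modZ_comp b'w2 comp0l.
Qed.

(* That is, the completion is hereditary modulo [Z]. *)
Lemma bongartz_kernel_splits B B' (f : hom B B') : bongartz_object B -> bongartz_object B' ->
  exists r : hom B B, π (f ⊚ r) = 0 /\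
    forall W (c : hom W B), T W -> π (f ⊚ c) = 0 -> π (r ⊚ c) = π c.
Proof.
move=> bonB [X' [Z0' [i' [q' [d' bon']]]]].
have [T0 [p [A [a [b' [ap fb' univ b'0]]]]]] := bongartz_kernel_presentation f bon' bonB.
have [X [Z0 [i [q [d bon]]]]] := bonB; have [TX ZZ0 iqd _] := bon.
have lift W (c : hom W B) : T W -> exists w, π (f ⊚ c) = π (p ⊚ a ⊚ w).
  move=> TW; have [h hE] := ap _ (f ⊚ c) TW.
  have [|w wE] := univ _ h c TW; first by rewrite hE.
  by exists w; rewrite hE wE compA.
have [w' w'E] := lift _ i TX.
(* [f] kills [i - b' ⊚ w'] modulo [Z]; then [r' = 1 - r] sends [i] to the chosen lift [b' ⊚ w']. *)
have [r rE] := bongartz_extend bon (i - b' ⊚ w') (bongartz_perp1 bon).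
pose r' := idm B - r.
have r'i : r' ⊚ i = b' ⊚ w' by rewrite compBl comp1m -rE opprB addrC subrK.
have fr0 : π (f ⊚ r) = 0.
  apply: (bongartz_cancel bon).
  by rewrite -compA -rE compBr modZB compA fb' // w'E subrr.
have b'eq W (w1 w2 : hom W A) : T W -> π (p ⊚ a ⊚ w1) = π (p ⊚ a ⊚ w2) ->
    π (b' ⊚ w1) = π (b' ⊚ w2).
  move=> TW e; apply/eqP; rewrite -subr_eq0 -modZB -compBr; apply/eqP/b'0 => //.
  by rewrite compBr modZB e subrr.
have r'ic W (c : hom W X) (w : hom W A) : T W -> π (f ⊚ i ⊚ c) = π (p ⊚ a ⊚ w) ->
    π (r' ⊚ i ⊚ c) = π (b' ⊚ w).
  move=> TW fic; rewrite r'i -compA; apply: b'eq => //.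
  by rewrite -fic compA modZ_comp -w'E -modZ_comp.
(* A [T]-cover of [Z0] lifts to [n : S0 -> B], and every map from [T] to [B] is a combination of [i]
   and [n]. *)
have [S1 [S0 [s [p0 [e0 [TS1 TS0 sp0 ap0]]]]]] := ct_resolution hT ctT Z0.
have [n nE] : exists n, p0 = q ⊚ n.
  by apply: (dist_ker' hT iqd); apply: (ct_rigid ctT).
have [h hE] : exists h, n ⊚ s = i ⊚ h.
  by apply: (dist_ker hT iqd); rewrite compA -nE (dist_comp0 hT sp0).
have [wn wnE] := lift _ n TS0.
have r'n : π (r' ⊚ n) = π (b' ⊚ wn).
  apply/eqP; rewrite -subr_eq0 -modZB; apply/eqP; set D := _ - _.
  have : π (D ⊚ s) = 0.
    rewrite compBl modZB -compA hE compA (r'ic _ h (wn ⊚ s)) //.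
      by rewrite compA subrr.
    by rewrite -compA -hE !compA modZ_comp wnE -modZ_comp.
  move/modZ_eq0 => [Z2 [u [v [ZZ2 vu]]]].
  have [u' uE] : exists u', u = u' ⊚ s.
    by apply: (dist_extend hT sp0); apply: rigZ.
  have [|y yE] := dist_coker hT sp0 (x := D - v ⊚ u').
    by rewrite compBl -vu -compA -uE subrr.
  by rewrite -[D](subrK (v ⊚ u')) yE modZD !modZ_through // addr0.
exists r; split=> // W c TW fc.
have [c0 c0E] := ap0 _ (q ⊚ c) TW.
have [|c1 c1E] := dist_ker hT iqd (x := c - n ⊚ c0).
  by rewrite compBr c0E nE compA subrr.
have cE : c = i ⊚ c1 + n ⊚ c0 by rewrite -c1E subrK.
suff : π (r' ⊚ c) = 0.
  by rewrite compBl comp1m modZB => /eqP; rewrite subr_eq0 => /eqP.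
have fic1 : π (f ⊚ i ⊚ c1) = π (p ⊚ a ⊚ (- (wn ⊚ c0))).
  rewrite -compA -c1E compBr modZB fc sub0r compNr -[in RHS]sub0r modZB modZ0 sub0r.
  by congr (- _); rewrite !compA modZ_comp wnE -modZ_comp.
rewrite cE compDr modZD !compA (r'ic _ _ _ TW fic1) [π (r' ⊚ n ⊚ c0)]modZ_comp r'n -modZ_comp.
by rewrite -modZD -compA -compDr addNr comp0r modZ0.
Qed.

End BongartzCompletion.

(** * The reduction *)

Section Transport.
Variables (k : fieldType) (D : linCat k).
Implicit Types X Y W A B : D.

Lemma local_end_iso A Y (f : hom A Y) : is_iso f -> local_end A -> local_end Y.
Proof.
move=> [g [gf fg]] [nA lA]; split=> [Y0|u v nu nv uv].
  by apply: nA; apply: is_zero_retract gf Y0.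
have fi : is_iso f by exists g.
have gi : is_iso g by exists f.
have conj (w : hom Y Y) : is_iso (g ⊚ w ⊚ f) -> is_iso w.
  move=> gwf; have -> : w = f ⊚ (g ⊚ w ⊚ f) ⊚ g.
    by rewrite !compA fg comp1m -compA fg compm1.
  by apply: is_iso_comp => //; apply: is_iso_comp.
apply: (lA (g ⊚ u ⊚ f) (g ⊚ v ⊚ f)); try by move/conj.
by rewrite -compDl -compDr; apply: is_iso_comp => //; apply: is_iso_comp.
Qed.

Lemma biproduct_zero_iso A B X (i : hom A X) (j : hom B X) (p : hom X A) (q : hom X B) :
  p ⊚ i = idm A -> i ⊚ p + j ⊚ q = idm X -> is_zero B -> is_iso i.
Proof.
move=> pi ip [z _]; exists p; split=> //.
by rewrite -ip (z _ j) comp0l addr0.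
Qed.

(** Cancel [f] from a nontrivial relation between its powers until the constant coefficient is
    nonzero, then solve for the identity. *)
Lemma mono_endo_right_inverse X (f : hom X X) : hom_finite D ->
  (forall c : hom X X, f ⊚ c = 0 -> c = 0) -> exists g, f ⊚ g = idm X.
Proof.
move=> hfin mono; have [n [c [[l cl] cf]]] := epow_dependent hfin f.
pose c' i := c (inord i).
have {cl} : exists2 i, (i < n.+1)%N & c' i != 0 by exists l; rewrite ?ltn_ord // /c' inord_val.
have {cf} : \sum_(i < n.+1) c' i *: epow f i = 0.
  by rewrite -[RHS]cf; apply: eq_bigr => i _; rewrite /c' inord_val.
move: (n.+1) c' => {l}{c}{}n c; elim: n c => [|n IHn] c; first by move=> _ [].
rewrite big_ord_recl /=.
have -> : \sum_(i < n) c (bump 0 i) *: epow f (bump 0 i) = f ⊚ \sum_(i < n) c i.+1 *: epow f i.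
  by rewrite comp_sumr; apply: eq_bigr => i _; rewrite compZr.
have [c00|c0] := eqVneq (c 0%N) 0.
  rewrite c00 scale0r add0r => /mono s0 [[|i] ilt ci]; first by rewrite c00 eqxx in ci.
  by apply: (IHn (fun i => c i.+1) s0); exists i.
move=> /eqP; rewrite addr_eq0 => /eqP e _.
exists (- ((c 0%N)^-1 *: \sum_(i < n) c i.+1 *: epow f i)).
by rewrite compNr compZr -scalerN -e scalerA mulVf // scale1r.
Qed.

(** The composite around the cycle is a monic, hence invertible, endomorphism of [X 0], so the first
    map is a split monomorphism into a local object. *)
Lemma no_mono_cycle n (X : nat -> D) (f : forall i, hom (X i) (X i.+1)) :
  hom_finite D -> (0 < n)%N -> isomorphic (X 0%N) (X n) ->
  ~ is_zero (X 0%N) -> local_end (X 1%N) -> ~ is_iso (f 0%N) ->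
  (forall i, (i < n)%N -> forall c : hom (X 0%N) (X i), f i ⊚ c = 0 -> c = 0) -> False.
Proof.
move=> hfin; case: n => // n _ [h [h' [h'h hh']]] nX0 lX1 nf0 mono.
have [g gmono] : exists g : hom (X 1%N) (X n.+1),
    forall c : hom (X 0%N) (X 0%N), g ⊚ f 0%N ⊚ c = 0 -> c = 0.
  elim: n {h h' h'h hh'} mono => [|n IHn] mono.
    by exists (idm _) => c; rewrite comp1m; apply: mono.
  have [|g gmono] := IHn; first by move=> i ilt; apply: mono; apply: ltnW.
  exists (f n.+1 ⊚ g) => c; rewrite -!(compA (f n.+1)) => /mono fg.
  by apply: gmono; apply: fg.
have h'0 W (c : hom W (X n.+1)) : h' ⊚ c = 0 -> c = 0.
  by move=> h'c; rewrite -[c]comp1m -hh' -compA h'c comp0r.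
have mono' (c : hom (X 0%N) (X 0%N)) : h' ⊚ g ⊚ f 0%N ⊚ c = 0 -> c = 0.
  by rewrite -!(compA h') => /h'0/gmono.
have [p fp] := mono_endo_right_inverse hfin mono'.
have pf : p ⊚ h' ⊚ g ⊚ f 0%N = idm _.
  apply/eqP; rewrite -subr_eq0; apply/eqP/mono'.
  by rewrite compBr compm1 !compA fp comp1m subrr.
by apply: nf0; apply: local_split_iso pf.
Qed.

End Transport.

Section FullSubcategory.
Variables (k : fieldType) (D : linCat k) (P : D -> Prop).
Implicit Types X Y : full_sub P.

(** Both facts hold by conversion; they unwrap the nested full subcategories of the reduction. *)
Lemma full_sub_isomorphic X Y : isomorphic X Y -> isomorphic (sval X) (sval Y).
Proof. by []. Qed.

Lemma full_sub_nonzero_noniso X Y :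
  (exists f : hom X Y, f <> 0 /\ ~ is_iso f) ->
  exists f : hom (sval X) (sval Y), f <> 0 /\ ~ is_iso f.
Proof. by []. Qed.

End FullSubcategory.

(** * The completion as a directed cluster-tilting subcategory of the reduction *)

Section Reduction.
Variables (k : closedFieldType) (C : triCat k).
Hypotheses (hT : triangulated C) (hCY : calabi_yau2 C) (hKS : krull_schmidt C).
Variables (T Z : subcat C).
Hypotheses (ctT : cluster_tilting T) (dirT : directed (full_sub T)).
Hypotheses (ffZ : functorially_finite Z) (rigZ : rigid Z).

Let hfin : hom_finite C. Proof. by case: hCY. Qed.

Local Notation π f := (modZ Z f).
Local Notation Q := (quot_cat (factor_ideal Z)).
Local Notation completion := (completion T Z).
Implicit Types X Y : reduction_cat Z.

(** Given [f : W -> X1[1]] with [W] in [Z], the approximation property and duality give [c[1] ⊚ f =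
    0]; so [f] lifts to [E[1]], where rigidity makes it zero. *)
Lemma suspension_exists (x : C) : exists (E X1 : C) (a : hom x E) (b : hom E X1) (c : hom X1 x[1]),
  [/\ min_left_approx Z a, dist a b c & perp1 Z X1].
Proof.
have [_ /(_ x)[Z0 [a0 [ZZ0 aa0]]]] := ffZ.
have [E [i [p [pi ipa ma]]]] := left_minimal_version hT hKS hfin a0.
have aE W (u : hom x W) : Z W -> exists v : hom E W, v ⊚ (p ⊚ a0) = u.
  by move=> /(aa0 _ u)[v <-]; exists (v ⊚ i); rewrite -{2}ipa !compA.
have [X1 [b [c abc]]] := cone_exists hT (p ⊚ a0).
have pX1 : perp1 Z X1.
  move=> W ZW f; have cf : c⟦1⟧ ⊚ f = 0.
    apply: (shift2_ker0 hT hCY (f := p ⊚ a0)) => [u|].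
      by have [v <-] := aE _ u ZW; exists v.
    by rewrite compA -shift_comp // (dist_comp0'' hT abc) shift0 // comp0l.
  have [g ->] := dist_ker_shift hT (proj1 (rotate hT _ _ _) abc) cf.
  have -> : g = 0; last exact: comp0r.
  by rewrite -[g]comp1m -shift_id // -pi shift_comp // -compA (rigZ ZW ZZ0 (i⟦1⟧ ⊚ g)) comp0r.
exists E, X1, (p ⊚ a0), b, c; split=> //; split=> //.
have [B [v [s [sv su rv us]]]] := split_mono_complement hT pi.
by exists Z0, B; split=> //; exists i, v, p, s.
Qed.

Lemma suspensionP X : is_suspension (suspension X).
Proof.
apply: epsilon_spec; have [E [X1 [a [b [c [ma abc pX1]]]]]] := suspension_exists (und X).
by exists (@SuspData _ _ _ X E (exist _ X1 pX1) a b c).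
Qed.

Lemma suspension_mid X : exists Z0 (i : hom (sd_mid (suspension X)) Z0) p,
  p ⊚ i = idm _ /\ Z Z0.
Proof.
have [[[Z0 [B [ZZ0 [i [_ [p [_ [pi _ _ _ _]]]]]]]] _ _] _] := suspensionP X.
by exists Z0, i, p.
Qed.

(** A map [X -> Y[1]] lifts to the suspension of [Y], and maps from [Z] to [Y[1]] vanish.
    Conversely, a map to the suspension that dies in [Y[1]] factors through the middle term, a
    retract of an object of [Z]. *)
Lemma hom_suspension X Y :
  (forall f : hom X (susp (suspension Y)), f = 0) <->
  (forall f : hom (und X) (und Y)[1], f = 0).
Proof.
have [[_ aE _] abc] := suspensionP Y; have [Z0 [i [p [pi ZZ0]]]] := suspension_mid Y.
set a := sd_in _ in aE abc; set b := sd_out _ in abc; set c := sd_conn _ in abc.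
split=> h f.
  have [|g ->] := dist_ker'' hT abc (x := f).
    rewrite -[LHS]comp1m -shift_id // -pi shift_comp // -compA.
    by rewrite (perp1_ext hT hCY (i⟦1⟧ ⊚ _) (svalP X) ZZ0) comp0r.
  have /modZ_eq0[W [u [v [ZW <-]]]] : π g = 0 := h (π g).
  by rewrite compA (svalP Y W ZW (c ⊚ v)) comp0l.
have [g gE] := modZ_surj f; rewrite -gE.
have [|m ->] := dist_ker' hT abc (x := g); first exact: h.
by rewrite -[m]comp1m -pi -!compA compA modZ_through.
Qed.

Lemma modZ_biproduct (A B W : C) : biproduct A B W -> @biproduct k Q A B W.
Proof.
move=> [i [j [p [q [pi qj pj qi ip]]]]].
exists (π i), (π j), (π p), (π q).
by rewrite -!modZ_comp -modZD pi qj pj qi ip !modZ0.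
Qed.

Definition reduced_completion : subcat (reduction Z).
Proof.
refine (@Subcat _ (reduction Z) (fun X => completion (und X)) _ _).
  have [O [ZO O0]] := subcat0 Z.
  have cO : completion O by apply: completionZ.
  exists (exist _ O cO.1); split=> //; apply/is_zero_id.
  by rewrite /= -[LHS]modZ_id (proj1 (is_zero_id O) O0) modZ0.
move=> A B cA cB; have [W biW] := biprod_exists hT (und A) (und B).
have cW : completion W by apply: completion_biproduct biW.
exists (exist _ W cW.1); split=> //; exact: (modZ_biproduct biW).
Defined.

Local Notation RT := reduced_completion.

Lemma reduced_completion_ff : functorially_finite RT.
Proof.
split=> X.
  have [Y [P [y [t [h [B [Z1 [iB [iZ [pB [pZ [_ cY cP ap _]]]]]]]]]]]] :=
    completion_resolution hT hCY ctT ffZ rigZ (svalP X).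
  exists (exist _ P cP.1), (π t); split=> // W u cW.
  have [u0 <-] := modZ_surj (u : @hom _ Q (und W) (und X)).
  have [v ->] := ap _ u0 cW; exists (π v); symmetry; exact: modZ_comp.
have [_ abc] := suspensionP X; have [Z0 [i [p [pi ZZ0]]]] := suspension_mid X.
have [|G [g [cG ag]]] := completion_left_approx hT hCY ctT ffZ rigZ abc _ (svalP (susp (suspension X))).
  by apply: completion_retract pi _ => //; apply: completionZ.
exists (exist _ G cG.1), (π g); split=> // W u cW.
have [u0 <-] := modZ_surj (u : @hom _ Q (und X) (und W)).
have [v ->] := ag _ u0 cW; exists (π v); symmetry; exact: modZ_comp.
Qed.

Lemma reduced_completion_ct : cluster_tilting RT.
Proof.
split; first exact: reduced_completion_ff.
  move=> X; split=> [cX Y cY|eX].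
    by apply/hom_suspension => f; apply: completion_ext cY cX.
  apply: completion_mem => // Y cY.
  exact/(hom_suspension (exist _ Y cY.1) X)/eX.
move=> X; split=> [cX Y cY|eX].
  by apply/hom_suspension => f; apply: completion_ext cX cY.
apply: completion_mem => // Y cY; apply: (ext1_sym hT hCY).
exact/(hom_suspension X (exist _ Y cY.1))/eX.
Qed.

Lemma modZ_is_iso (X Y : C) (f : hom X Y) : is_iso f -> is_iso (π f).
Proof. by move=> [g [gf fg]]; exists (π g); rewrite -!modZ_comp gf fg. Qed.

(** If [F + G] has inverse [H], then [f ⊚ h] or [1 - f ⊚ h] is invertible in [C]; modulo [Z] these
    are [F ⊚ H] and [G ⊚ H]. *)
Lemma modZ_local (A : C) : local_end A -> ~ @is_zero k Q A -> @local_end k Q A.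
Proof.
move=> lA nA; split=> // F G nF nG [H [HFG FGH]].
have [f fE] := modZ_surj F; have [g gE] := modZ_surj G; have [h hE] := modZ_surj H.
have iH : is_iso H by exists (F + G).
have cancel (K : @hom k Q A A) : is_iso (K ⊚ H) -> is_iso K.
  move=> iKH; have -> : K = K ⊚ H ⊚ (F + G) by rewrite -compA HFG compm1.
  by apply: is_iso_comp => //; exists H.
have [|ifh|igh] := @local_sum _ _ _ (f ⊚ h) (idm A - f ⊚ h) lA.
- rewrite addrC subrK; exact: is_iso_id.
- by apply: nF; apply: cancel; rewrite -fE -hE -modZ_comp; apply: modZ_is_iso.
- apply: nG; apply: cancel; have := modZ_is_iso igh.
  by rewrite modZB modZ_comp fE hE modZ_id -FGH compDl addrAC subrr add0r.
Qed.

(** Split off local summands in [C]: one of [A] and [w'] is zero modulo [Z]. If it is [A], continue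
    with [w']; otherwise the object is [A] modulo [Z]. *)
Lemma reduced_indecomposable_local (Y : full_sub RT) :
  indecomposable Y -> @local_end k Q (und (sval Y)).
Proof.
move=> indY; set y := und _; have cy : completion y := svalP Y.
have [n yn] := ks_sum hT hKS y.
suff gen m (w : C) : sum_of_locals m w -> completion w ->
    (exists s : @hom k Q w y, is_iso s) -> @local_end k Q y.
  by apply: gen yn cy _; exists (idm _); apply: is_iso_id.
elim=> [{}w w0|{}m A w' {}w lA _ IH biw] cw [s [s' [s's ss']]].
  case: indY => nY _; case: nY; apply/is_zero_id.
  have -> : idm Y = s ⊚ s' :> @hom k Q _ _ by rewrite ss'.
  by rewrite -[s']comp1m -modZ_id (proj1 (is_zero_id w) w0) modZ0 comp0l comp0r.
have [i [j [p [q [pi qj pj qi ip]]]]] := biw.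
have cA : completion A by apply: completion_retract pi cw.
have cw' : completion w' by apply: completion_retract qj cw.
have [I [J [P [R [PI RJ PJ RI IP]]]]] := modZ_biproduct biw.
have PI' : (P ⊚ s') ⊚ (s ⊚ I) = idm _ by rewrite compA -(compA P) s's compm1.
have RJ' : (R ⊚ s') ⊚ (s ⊚ J) = idm _ by rewrite compA -(compA R) s's compm1.
have IP' : (s ⊚ I) ⊚ (P ⊚ s') + (s ⊚ J) ⊚ (R ⊚ s') = idm _.
  by rewrite !compA -compDl -!(compA s) -compDr IP compm1 ss'.
have := indY.2 (exist _ (exist _ A cA.1) cA) (exist _ (exist _ w' cw'.1) cw').
case.
- exists (s ⊚ I), (s ⊚ J), (P ⊚ s'), (R ⊚ s'); split=> //.
    by rewrite [LHS]compA -(compA P) s's compm1.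
  by rewrite [LHS]compA -(compA R) s's compm1.
- move=> /is_zero_id A0D; apply: IH cw' _; exists (s ⊚ J).
  have A0 : @is_zero k Q A by apply/is_zero_id.
  have IP'' := IP'; rewrite addrC in IP''.
  exact: (@biproduct_zero_iso k Q _ _ _ _ _ _ _ RJ' IP'' A0).
move=> /is_zero_id w'0D; have w'0 : @is_zero k Q w' by apply/is_zero_id.
have isoA := @biproduct_zero_iso k Q _ _ _ _ _ _ _ PI' IP' w'0.
apply: (local_end_iso isoA); apply: modZ_local => // A0.
case: indY => nY _; case: nY; have [t [_ it]] := isoA.
by apply/is_zero_id; apply: (proj1 (is_zero_id (y : Q))); apply: is_zero_retract it A0.
Qed.

(** The split kernel carried over to [Y] is [r'], killed by [f] and fixing [c]. As [f] is nonzero,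
    [r'] is not invertible, so [1 - r'] is, and it kills [c]. *)
Lemma reduced_mono (Y Y' W : C) (f : @hom k Q Y Y') (c : @hom k Q W Y) :
  completion Y -> completion Y' -> completion W -> @local_end k Q Y -> f <> 0 ->
  f ⊚ c = 0 -> c = 0.
Proof.
move=> cY cY' cW lY f0 fc.
have [B [s [b [bonB bs]]]] := completion_mod_retract hT hCY ctT ffZ rigZ cY.
have [B' [s' [b' [bonB' bs']]]] := completion_mod_retract hT hCY ctT ffZ rigZ cY'.
have [B2 [s2 [b2 [[X2 [Z2 [i2 [q2 [d2 bon2]]]]] bs2]]]] :=
  completion_mod_retract hT hCY ctT ffZ rigZ cW.
have [g gE] := modZ_surj (π s' ⊚ f ⊚ π b).
have [r [gr rc]] := bongartz_kernel_splits hT hCY hKS ctT ffZ rigZ dirT g bonB bonB'.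
pose r' := π b ⊚ π r ⊚ π s.
have fr' : f ⊚ r' = 0.
  rewrite -[LHS]comp1m -bs' !compA -(compA _ (π s')) -(compA _ (_ ⊚ f)) -gE.
  by rewrite -(compA _ (π g)) -modZ_comp gr comp0r comp0l.
have r'c : r' ⊚ c = c.
  have [e eE] := modZ_surj (π s ⊚ c ⊚ π b2).
  (* [r] is controlled on sources in [T], so the identity is checked on [X2] and then cancelled to
     [B2]. *)
  have : π ((r ⊚ e - e) ⊚ i2) = 0.
    have [TX2 _ _ _] := bon2.
    rewrite compBl modZB -compA rc ?subrr // compA 2!modZ_comp gE eE.
    rewrite !compA -(compA _ (π b)) bs compm1 -(compA _ f) fc.
    by rewrite comp0r !comp0l.
  move=> /(bongartz_cancel hT rigZ bon2); rewrite modZB modZ_comp eE => /eqP.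
  rewrite subr_eq0 => /eqP re.
  have -> : r' ⊚ c = π b ⊚ (π r ⊚ (π s ⊚ c ⊚ π b2)) ⊚ π s2.
    by rewrite !compA -(compA _ (π b2)) bs2 compm1.
  by rewrite re !compA bs comp1m -compA bs2 compm1.
have [|ir|ir] := @local_sum k Q _ r' (@idm k Q Y - r') lY.
- rewrite addrC subrK; exact: is_iso_id.
- case: f0; have [t [_ rt]] := ir.
  by rewrite -[f]compm1 -rt compA fr' comp0l.
have [t [tr _]] := ir.
by rewrite -[c]comp1m -tr -compA compBl comp1m r'c subrr comp0r.
Qed.

Lemma modZ_hom_finite : hom_finite Q.
Proof.
move=> X Y; have [n [e he]] := hfin X Y; exists n, (fun i => π (e i)) => f.
have [g <-] := modZ_surj f; have [c ->] := he g; exists c.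
elim/big_rec2: _ => [|i y z _ <-]; first exact: modZ0.
by rewrite modZD modZZ.
Qed.

Lemma reduced_completion_directed : directed (full_sub RT).
Proof.
move=> n X [n0 indX isoX nz].
pose u i : Q := und (sval (X i)).
have cu i : completion (u i) := svalP (X i).
have lu i : (i <= n)%N -> @local_end k Q (u i).
  by move=> /indX; apply: reduced_indecomposable_local.
have nzQ i : (i < n)%N -> exists f : @hom k Q (u i) (u i.+1), f <> 0 /\ ~ is_iso f.
  by move=> /nz/full_sub_nonzero_noniso/(@full_sub_nonzero_noniso k Q (@perp1 k C Z)).
have {}isoX : @isomorphic k Q (u 0%N) (u n).
  exact: (@full_sub_isomorphic k Q (@perp1 k C Z) _ _ (full_sub_isomorphic isoX)).
clearbody u; clear X indX nz.
(* A map is needed at every index; beyond the cycle it is 0. *)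
pose f i : @hom k Q (u i) (u i.+1) :=
  if pselect (i < n)%N is left lt_in then sval (cid (nzQ i lt_in)) else 0.
have fP i : (i < n)%N -> f i <> 0 /\ ~ is_iso (f i).
  by move=> lt_in; rewrite /f; case: pselect => // h; apply: (svalP (cid (nzQ i h))).
apply: (no_mono_cycle (f := f) modZ_hom_finite n0 isoX) => [|||i lt_in c].
- by case: (lu 0%N).
- exact: lu.
- by case: (fP 0%N).
- by apply: reduced_mono => //; [apply: lu; apply: ltnW | case: (fP i)].
Qed.

End Reduction.

Theorem theorem1p5 (k : closedFieldType) (C : triCat k)
    (hT : triangulated C) (hCY : calabi_yau2 C) (hKS : krull_schmidt C)
    (Z : subcat C) (hff : functorially_finite Z) (hrig : rigid Z) :
  (exists T : subcat C, cluster_tilting T /\ directed (full_sub T)) ->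
  exists T : subcat (reduction Z), cluster_tilting T /\ directed (full_sub T).
Proof.
move=> [T [ctT dirT]]; exists (reduced_completion hT hCY ctT hff hrig); split.
  exact: reduced_completion_ct.
exact: reduced_completion_directed.
Qed.
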